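(* Let $(X,\Phi)$ be a $C^2$ smooth regular flow on a compact manifold $X$. Assume that for any $t>0$ the number of periodic orbits with period less than $t$ is finite. Then $(X,\Phi)$ has the smooth small flow boundary property.
   Context: Write $\Phi=(\phi_t)_{t\in\mathbb R}$. The flow is regular if no point is fixed by all $\phi_t$. For $E\subset X$ and an interval $I$, $\phi_I(E)=\{\phi_t(x):x\in E,t\in I\}$. A cross-section of time $\eta>0$ is a set $S\subset X$ such that $(x,t)\mapsto\phi_t(x)$ is one-to-one on $S\times[-\eta,\eta]$. For a closed cross-section $S$ of time $\eta$ and $0<\zeta\le\eta$ put $S_\zeta=\phi_{[-\zeta,\zeta]}(S)$; the flow interior is $\mathrm{Int}^\Phi(S)=\mathrm{Int}(S_\zeta)\cap S$ (independent of $0<\zeta\le\eta$), and the flow boundary is $\partial^\Phi S=S\setminus\mathrm{Int}^\Phi(S)$. $S$ has a small flow boundary if $\phi_{[-\eta,\eta]}(\partial^\Phi S)$ has measure zero for every $\Phi$-invariant Borel probability measure. Smooth small flow boundary property of a $C^2$ flow: for any $x\in X$ and any closed cross-section $S'$ given by a $C^1$ smooth (embedded closed) disc transverse to the $C^1$ vector field generating the flow, with $x\in\mathrm{Int}^\Phi(S')$, there exists a closed cross-section $S\subset S'$, also given by a $C^1$ smooth disc transverse to this vector field, with $x\in\mathrm{Int}^\Phi(S)$ and such that $S$ has a small flow boundary. *)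

(* Defs.v *)
(* MathComp-Analysis.  The reals are an arbitrary [R : realType]; R^n is
   ['rV[R]_n]. *)
From HB Require Import structures.
From mathcomp Require Import all_boot all_order all_algebra.
From mathcomp Require Import all_classical all_reals all_analysis.

Set Implicit Arguments.
Unset Strict Implicit.
Unset Printing Implicit Defensive.

Import Order.TTheory GRing.Theory Num.Theory.
Import numFieldNormedType.Exports.

Local Open Scope classical_set_scope.
Local Open Scope ring_scope.

(** Differentiable manifolds *)

(* Meant for [U] open.  For finite-dimensional [V], requiring every directional
   derivative to be C^k is the usual C^(k+1) condition. *)
Fixpoint Ck (R : realType) (V W : normedModType R) (k : nat) (U : set V)
    (f : V -> W) : Prop :=
  match k with
  | 0 => forall x, U x -> {for x, continuous f}
  | k'.+1 => (forall x, U x -> differentiable f x) /\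
             (forall v : V, Ck k' U (fun x => 'D_v f x))
  end.

(* [chart_map] and [chart_inv] are total functions, but only their restrictions
   to [chart_dom] and [chart_cod] matter. *)
Record chart (R : realType) (d : nat) (X : topologicalType) := Chart {
  chart_dom : set X ;
  chart_cod : set 'rV[R]_d ;
  chart_map : X -> 'rV[R]_d ;
  chart_inv : 'rV[R]_d -> X ;
  chart_dom_open : open chart_dom ;
  chart_cod_open : open chart_cod ;
  chart_map_cod : forall x, chart_dom x -> chart_cod (chart_map x) ;
  chart_inv_dom : forall u, chart_cod u -> chart_dom (chart_inv u) ;
  chart_mapK : forall x, chart_dom x -> chart_inv (chart_map x) = x ;
  chart_invK : forall u, chart_cod u -> chart_map (chart_inv u) = u ;
  chart_map_cts : forall x, chart_dom x -> {for x, continuous chart_map} ;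
  chart_inv_cts : forall u, chart_cod u -> {for u, continuous chart_inv} }.

(* A C^k map on the open set [U] of a normed space, with values in the manifold
   with atlas [A]. *)
Definition Ck_into (R : realType) (d : nat) (X : topologicalType)
    (A : set (chart R d X)) (V : normedModType R) (k : nat) (U : set V)
    (f : V -> X) : Prop :=
  (forall u, U u -> {for u, continuous f}) /\
  (forall c, A c ->
     Ck k (U `&` f @^-1` chart_dom c) (fun u => chart_map c (f u))).

Definition Ck_atlas (R : realType) (d : nat) (X : topologicalType) (k : nat)
    (A : set (chart R d X)) : Prop :=
  (forall x : X, exists2 c, A c & chart_dom c x) /\
  (forall c, A c -> Ck_into A k (chart_cod c) (chart_inv c)).

(* Compact manifold without boundary, of dimension [d] and class C^k; second
   countability is automatic by compactness. *)
Definition compact_manifold (R : realType) (d : nat) (X : topologicalType)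
    (k : nat) (A : set (chart R d X)) : Prop :=
  [/\ hausdorff_space X, compact [set: X] & Ck_atlas k A].

(** Flows *)

Definition is_flow (R : realType) (X : Type) (phi : R -> X -> X) : Prop :=
  (forall x, phi 0 x = x) /\
  (forall s t x, phi (s + t) x = phi s (phi t x)).

(* Joint C^k regularity of (t, x) |-> phi_t(x) on R x X. *)
Definition Ck_flow (R : realType) (d : nat) (X : topologicalType) (k : nat)
    (A : set (chart R d X)) (phi : R -> X -> X) : Prop :=
  [/\ is_flow phi,
      continuous (fun p : R * X => phi p.1 p.2) &
      forall c, A c ->
        Ck_into A k [set p : R * 'rV[R]_d | chart_cod c p.2]
          (fun p => phi p.1 (chart_inv c p.2))].

Definition regular_flow (R : realType) (X : Type) (phi : R -> X -> X) : Prop :=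
  forall x, exists t, phi t x <> x.

(* The expression in the chart [c] of the generating vector field. *)
Definition generator (R : realType) (d : nat) (X : topologicalType)
    (phi : R -> X -> X) (c : chart R d X) (x : X) : 'rV[R]_d :=
  derive1 (fun t : R => chart_map c (phi t x)) 0.

Definition flow_orbit (R : realType) (X : Type) (phi : R -> X -> X) (x : X)
    : set X :=
  [set phi t x | t in [set: R]].

Definition least_period (R : realType) (X : Type) (phi : R -> X -> X) (x : X)
    (T : R) : Prop :=
  [/\ 0 < T, phi T x = x & forall s, 0 < s -> s < T -> phi s x <> x].

Definition periodic_orbits_lt (R : realType) (X : Type) (phi : R -> X -> X)
    (t : R) : set (set X) :=
  [set flow_orbit phi x | x in [set x | exists2 T, least_period phi x T & T < t]].

(** Cross-sections *)

Definition flow_tube (R : realType) (X : Type) (phi : R -> X -> X) (zeta : R)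
    (E : set X) : set X :=
  [set phi t x | t in `[- zeta, zeta]%classic & x in E].

Definition cross_section (R : realType) (X : Type) (phi : R -> X -> X)
    (eta : R) (S : set X) : Prop :=
  0 < eta /\
  forall x y s t, S x -> S y -> `[- eta, eta]%classic s ->
    `[- eta, eta]%classic t -> phi s x = phi t y -> x = y /\ s = t.

Definition closed_cross_section (R : realType) (X : topologicalType)
    (phi : R -> X -> X) (eta : R) (S : set X) : Prop :=
  closed S /\ cross_section phi eta S.

(* For a closed cross-section of time [eta] this does not depend on
   [0 < zeta <= eta]; below it is used with [zeta := eta]. *)
Definition flow_interior (R : realType) (X : topologicalType)
    (phi : R -> X -> X) (zeta : R) (S : set X) : set X :=
  (flow_tube phi zeta S)° `&` S.

Definition flow_boundary (R : realType) (X : topologicalType)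
    (phi : R -> X -> X) (zeta : R) (S : set X) : set X :=
  S `\` flow_interior phi zeta S.

Definition borel (X : ptopologicalType) := g_sigma_algebraType (@open X).

Definition invariant_probability (R : realType) (X : ptopologicalType)
    (phi : R -> X -> X) (mu : probability (borel X) R) : Prop :=
  forall (t : R) (B : set (borel X)), measurable B -> mu (phi t @^-1` B) = mu B.

Definition small_flow_boundary (R : realType) (X : ptopologicalType)
    (phi : R -> X -> X) (eta : R) (S : set X) : Prop :=
  forall mu : probability (borel X) R, invariant_probability phi mu ->
    mu (flow_tube phi eta (flow_boundary phi eta S)) = 0%E.

(* The norm of ['rV[R]_n] is the sup norm, whose balls are cubes; a smooth disc
   is modelled on the Euclidean ball. *)
Definition euclidean_ball (R : realType) (n : nat) : set 'rV[R]_n :=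
  [set u | \sum_(i < n) u 0 i ^+ 2 <= 1].

(* [S] is the image of the closed unit ball of R^(d-1) under a C^1 embedding
   (C^1 on a neighbourhood of the ball; an injective immersion of the compact
   ball is an embedding), and at every point of [S] the tangent space of [S]
   and the generating vector field span the tangent space of [X]. *)
Definition transverse_C1_disc (R : realType) (d : nat) (X : topologicalType)
    (A : set (chart R d X)) (phi : R -> X -> X) (S : set X) : Prop :=
  exists (U : set 'rV[R]_d.-1) (f : 'rV[R]_d.-1 -> X),
    [/\ open U /\ @euclidean_ball R d.-1 `<=` U,
        Ck_into A 1 U f,
        forall u v, euclidean_ball u -> euclidean_ball v -> f u = f v -> u = v,
        (forall c u, A c -> euclidean_ball u -> chart_dom c (f u) ->
          (forall v, 'd (chart_map c \o f) u v = 0 -> v = 0) /\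
          (forall w, exists (a : R) v,
             w = a *: generator phi c (f u) + 'd (chart_map c \o f) u v)) &
        S = [set f u | u in @euclidean_ball R d.-1]].

Definition smooth_small_flow_boundary_property (R : realType) (d : nat)
    (X : ptopologicalType) (A : set (chart R d X)) (phi : R -> X -> X) : Prop :=
  forall (x : X) (eta' : R) (S' : set X),
    closed_cross_section phi eta' S' -> transverse_C1_disc A phi S' ->
    flow_interior phi eta' S' x ->
  exists (eta : R) (S : set X),
    [/\ S `<=` S',
        closed_cross_section phi eta S /\ transverse_C1_disc A phi S,
        flow_interior phi eta S x &
        small_flow_boundary phi eta S].

(* Main.v *)
Require Import Defs.
From HB Require Import structures.
From mathcomp Require Import all_boot all_order all_algebra.
From mathcomp Require Import all_classical all_reals all_analysis.
From mathcomp Require Import ring lra zify.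
Set Implicit Arguments.
Unset Strict Implicit.
Unset Printing Implicit Defensive.
Import Order.TTheory GRing.Theory Num.Theory.
Import numFieldNormedType.Exports.
Local Open Scope classical_set_scope.
Local Open Scope ring_scope.

(** Write n = d - 1 and let f : ball -> S' parametrize the given section.  By
    Poincare recurrence ([invariant_recurrence]) a tube of positive measure
    around the boundary of a disc contains a point that comes back to the tube
    infinitely often.  So a disc has a small flow boundary as soon as its
    boundary contains no periodic point and no orbit meets it in n + 1 distinct
    points ([recurrence_free_small_boundary]).  Such a disc exists for reasons
    of general position.

    Around the point f(x0) of the section, consider the discs S_a which are the
    images under f of the perturbed balls
      u |-> x0 + r (1 + q_a(u)) u,    q_a(u) = sum_(k, j) a_kj l_k(u)^j,
    where a is a small K x (n + 1) matrix and the l_k are the linear forms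
    (1, k, k^2, ...).  A point x0 + r nu theta, with theta a unit vector, lies on
    the boundary of the ball of parameter a exactly when nu = 1 + q_a(theta),
    and this equation is affine in a.  For n + 1 distinct unit vectors some l_k
    separates them ([separating_moment_form]), and then inverting a Vandermonde
    matrix expresses the k-th row of a through the other rows and the data of
    the n + 1 equations ([ridge_coef_stable]).  On the other hand n + 1 points
    of one orbit are, locally, Lipschitz functions of the first one, because
    the transitions along the flow from the section to itself are locally
    Lipschitz ([flow_transition_lipschitz]).  Hence the parameters a for which
    the boundary of S_a contains n + 1 distinct points of an orbit form a
    countable union of sets on which a is a Lipschitz function of
    n + (K - 1)(n + 1) < K (n + 1) real numbers.  A set with this property is
    called thin below; a pigeonhole argument on grids shows that its closure
    has empty interior ([thin_closure_nowhere_dense]).  The periodic points of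
    the section are countable in number, and each of them lies on the boundary
    of S_a only for a in a hyperplane, which is thin as well.  By Baire's theorem
    some arbitrarily small a avoids all these sets ([generic_param]).

    Transversality enters through a lower bound for the differential of
    (s, u) |-> phi_s(f u).  As the flow tube of S' is known to contain a
    neighbourhood of the point, this bound and the compactness of the ball
    yield all that is needed about the local product structure. *)

(** * Thin sets of matrices *)

(* Matrices are complete and normed; Baire's theorem asks for the join of the
   two structures. *)
HB.instance Definition _ (R : realType) (m n : nat) := Complete.on 'M[R]_(m, n).

Lemma mx_norm_le (R : realType) m n (a : 'M[R]_(m, n)) (t : R) :
  0 <= t -> (forall i j, `|a i j| <= t) -> `|a| <= t.
Proof.
move=> t0 at_; rewrite /Num.Def.normr /= mx_normrE.
by apply/bigmax_leP; split=> // -[i j] _; apply: at_.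
Qed.

Lemma mx_entry_le (R : realType) m n (a : 'M[R]_(m, n)) i j :
  `|a i j| <= `|a|.
Proof.
rewrite [leRHS]/Num.Def.normr /= mx_normrE.
exact: (le_bigmax _ (fun ij => `|a ij.1 ij.2|) (i, j)).
Qed.

(** Points of [B] are determined, in a Lipschitz way, by fewer real coordinates
    [e] than the [p * q] coordinates of the ambient space. *)
Definition thin (R : realType) p q (B : set 'M[R]_(p, q)) : Prop :=
  exists (J : finType) (e : 'M[R]_(p, q) -> J -> R) (C b : R),
    [/\ (#|J| < p * q)%N,
        forall a, B a -> forall j, `|e a j| <= b &
        forall a a' t, B a -> B a' -> 0 <= t ->
          (forall j, `|e a j - e a' j| <= t) -> `|a - a'| <= C * t].

(** If the closure of [B] contained a ball, then each of the [L ^ (p * q)] points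
    of a grid of mesh [s / 2 L] in it would be close to a point of [B], and the
    coordinates [e] of these points would be separated by a multiple of [1 / L];
    but a box of dimension [#|J|] has room for only [O(L ^ #|J|)] such points. *)
Lemma thin_closure_nowhere_dense (R : realType) p q (B : set 'M[R]_(p, q)) :
  thin B -> forall a0 (s : R), 0 < s ->
  exists2 a, `|a - a0| < s & ~ closure B a.
Proof.
move=> [J [e [C0 [b0 [cardJ ble Cle]]]]] a0 s s0.
apply: contrapT => noa.
have Bcl a : `|a - a0| < s -> closure B a.
  by move=> aa0; apply: contrapT => nB; apply: noa; exists a.
pose C := `|C0| + 1; pose b := `|b0| + 1.
have C1 : 0 < C by rewrite ltr_pwDr.
have b1 : 0 < b by rewrite ltr_pwDr.
pose K := (Num.trunc (8 * b * C / s)).+1.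
(* [K * L] cells of width [h], defined below, cover the range of a coordinate
   [e _ j]; [L] is large enough for [L ^ #|J|.+1 > (K * L) ^ #|J|]. *)
pose L := (K ^ #|J|).+1.
have L0 : 0 < L%:R :> R by rewrite ltr0n.
pose g (f : {ffun 'I_p * 'I_q -> 'I_L}) : 'M[R]_(p, q) :=
  a0 + \matrix_(i, j) (s / 2 * ((f (i, j))%:R / L%:R)).
have gin f : `|g f - a0| < s.
  rewrite /g addrC addKr; apply: (@le_lt_trans _ _ (s / 2)); last by lra.
  apply: mx_norm_le => [|i j]; first by lra.
  rewrite mxE ger0_norm; last by rewrite mulr_ge0 ?divr_ge0 ?ler0n //; lra.
  rewrite ler_piMr ?divr_ge0 //; first by lra.
  by rewrite ler_pdivrMr // mul1r ler_nat ltnW.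
pose m := s / (8 * L%:R).
have m0 : 0 < m by rewrite divr_gt0 ?mulr_gt0.
have happrox f : exists x, B x /\ `|x - g f| < m.
  have [x [Bx xm]] := Bcl _ (gin f) _ (nbhsx_ballx (g f) m m0).
  exists x; split => //; move: xm; rewrite mx_norm_ball /ball_ /= distrC //.
have [ap apP] := choice happrox.
pose h := s / (4 * L%:R * C).
have h0 : 0 < h by rewrite divr_gt0 ?mulr_gt0.
have cell_lt f j : (Num.trunc ((e (ap f) j + b) / h) < K * L)%N.
  have /ler_normlP[e1 e2] := ble _ (apP f).1 j.
  have b0b : b0 <= b by rewrite /b; have := ler_norm b0; lra.
  rewrite truncn_lt_nat; last by rewrite divr_ge0 ?(ltW h0) //; lra.
  rewrite ltr_pdivrMr // natrM.
  apply: (@le_lt_trans _ _ (2 * b)); first by lra.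
  have := truncnS_gt (8 * b * C / s); rewrite -/K => Kb.
  have -> : K%:R * L%:R * h = K%:R * (s / (4 * C)).
    by rewrite /h; field; rewrite !gt_eqF.
  have -> : 2 * b = (8 * b * C / s) * (s / (4 * C)).
    by field; rewrite !gt_eqF.
  by rewrite ltr_pM2r // divr_gt0 ?mulr_gt0.
pose cell f : {ffun J -> 'I_(K * L)} := [ffun j => Ordinal (cell_lt f j)].
have cell_inj : injective cell.
  move=> f f' ff'; apply/ffunP => -[i k]; apply/val_inj/eqP => /=.
  have ehle j : `|e (ap f) j - e (ap f') j| <= h.
    have := congr1 (fun c : {ffun J -> 'I_(K * L)} => val (c j)) ff'.
    rewrite !ffunE /= => tr.
    have /ler_normlP[e1 e2] := ble _ (apP f).1 j.
    have /ler_normlP[e3 e4] := ble _ (apP f').1 j.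
    have b0b : b0 <= b by rewrite /b; have := ler_norm b0; lra.
    have x0 : 0 <= (e (ap f) j + b) / h by rewrite divr_ge0 ?(ltW h0) //; lra.
    have y0 : 0 <= (e (ap f') j + b) / h by rewrite divr_ge0 ?(ltW h0) //; lra.
    have /andP[x1 x2] := truncn_itv x0; have /andP[y1 y2] := truncn_itv y0.
    rewrite tr in x1 x2.
    rewrite ler_pdivlMr // in x1; rewrite ler_pdivlMr // in y1.
    rewrite ltr_pdivrMr // in x2; rewrite ltr_pdivrMr // in y2.
    rewrite -natr1 in x2 y2; rewrite mulrDl mul1r in x2 y2.
    by apply/ler_normlP; split; lra.
  have ap_close : `|ap f - ap f'| <= s / (4 * L%:R).
    have := Cle _ _ _ (apP f).1 (apP f').1 (ltW h0) ehle.
    have C0C : C0 <= C by rewrite /C; have := ler_norm C0; lra.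
    move=> /le_trans; apply; apply: (@le_trans _ _ (C * h)).
      by rewrite ler_pM2r.
    by rewrite /h le_eqVlt; apply/orP; left; apply/eqP; field; rewrite !gt_eqF.
  have g_close : `|g f - g f'| < s / (2 * L%:R).
    have -> : g f - g f' = - (ap f - g f) + (ap f' - g f') + (ap f - ap f').
      move: (g f) (g f') (ap f) (ap f') => w x y z.
      by apply/matrixP => u v; rewrite !mxE; ring.
    apply: (le_lt_trans (ler_normD _ _)).
    apply: (@lt_le_trans _ _ (m + m + s / (4 * L%:R))).
      rewrite ltr_leD //; apply: (le_lt_trans (ler_normD _ _)).
      by rewrite normrN; apply: ltrD; exact: (apP _).2.
    by rewrite /m le_eqVlt; apply/orP; left; apply/eqP; field; rewrite !gt_eqF.
  have := le_lt_trans (mx_entry_le (g f - g f') i k) g_close.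
  rewrite /g !mxE.
  set x := (f _ : nat); set y := (f' _ : nat).
  have -> : a0 i k + s / 2 * (x%:R / L%:R) - (a0 i k + s / 2 * (y%:R / L%:R)) =
            (x%:R - y%:R) * (s / (2 * L%:R)).
    by field; rewrite !gt_eqF.
  have sL : 0 < s / (2 * L%:R) by rewrite divr_gt0 // mulr_gt0.
  rewrite normrM [X in _ * X]gtr0_norm // gtr_pMl //.
  rewrite -[x%:R]/(x%:~R) -[y%:R]/(y%:~R) -rmorphB /= -intr_norm.
  rewrite -[1]/(1%:~R) ltr_int; lia.
have := leq_card cell cell_inj.
rewrite !card_ffun card_prod !card_ord.
move: cardJ; set c := #|J| => cardJ.
have Lc : (L ^ c.+1 <= L ^ (p * q))%N by rewrite leq_pexp2l.
move=> /(leq_trans Lc).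
rewrite expnS expnMn leq_pmul2r ?expn_gt0 //.
by rewrite /L ltnn.
Qed.

Lemma thin_cover_avoid (R : realType) p q (B : nat -> set 'M[R]_(p, q)) :
  (forall i, thin (B i)) -> forall s : R, 0 < s ->
  exists2 a, `|a| < s & forall i, ~ B i a.
Proof.
move=> thB s s0.
have oB : forall i, open (~` closure (B i)) /\ dense (~` closure (B i)).
  move=> i; split; first exact/closed_openC/closed_closure.
  move=> O [a0 Oa0] oO.
  have : nbhs a0 O by apply: open_nbhs_nbhs.
  move=> /nbhs_ballP[r r0 /= sub].
  have [a aa0 na] := thin_closure_nowhere_dense (thB i) a0 r0.
  exists a; split=> //; apply: sub.
  by rewrite mx_norm_ball /ball_ /= distrC.
have [||a [as_ aB]] := Baire oB (O := ball (0 : 'M[R]_(p, q)) s).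
- by exists 0; exact: ballxx.
- exact: ball_open.
exists a => [|i Bia].
  by move: as_; rewrite mx_norm_ball /ball_ /= sub0r normrN.
by apply: (aB i I) => //; exact: subset_closure.
Qed.

(** * Ridge polynomials *)

(** Evaluation at [u] of the point with parameter [k] of the moment curve; any
    two distinct vectors are separated by all but finitely many of these forms. *)
Definition moment_form (R : realType) n (k : nat) (u : 'rV[R]_n) : R :=
  \sum_(i < n) k%:R ^+ i * u 0 i.

Definition ridge_poly (R : realType) K m n (a : 'M[R]_(K, m)) (u : 'rV[R]_n) : R :=
  \sum_(k < K) \sum_(j < m) a k j * moment_form k u ^+ j.

Lemma moment_formB (R : realType) n k (u v : 'rV[R]_n) :
  moment_form k (u - v) = moment_form k u - moment_form k v.
Proof.
by rewrite /moment_form -sumrB; apply: eq_bigr => i _; rewrite !mxE mulrBr.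
Qed.

Lemma ridge_polyB (R : realType) K m n (a b : 'M[R]_(K, m)) (u : 'rV[R]_n) :
  ridge_poly (a - b) u = ridge_poly a u - ridge_poly b u.
Proof.
rewrite /ridge_poly -sumrB; apply: eq_bigr => k _.
by rewrite -sumrB; apply: eq_bigr => j _; rewrite !mxE mulrBl.
Qed.

Lemma moment_form_bound (R : realType) n k : exists2 A : R, 0 <= A &
  forall u : 'rV[R]_n, `|moment_form k u| <= A * `|u|.
Proof.
exists (\sum_(i < n) k%:R ^+ i) => [|u].
  by apply: sumr_ge0 => i _; rewrite exprn_ge0.
apply: (le_trans (ler_norm_sum _ _ _)); rewrite mulr_suml.
apply: ler_sum => i _; rewrite normrM normrX normr_nat.
by rewrite ler_wpM2l ?exprn_ge0 // mx_entry_le.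
Qed.

Lemma moment_form_exp_lipschitz (R : realType) n k j : exists2 A : R, 0 <= A &
  forall u v : 'rV[R]_n, `|u| <= 2 -> `|v| <= 2 ->
    `|moment_form k u ^+ j| <= A /\
    `|moment_form k u ^+ j - moment_form k v ^+ j| <= A * `|u - v|.
Proof.
have [A A0 Ale] := moment_form_bound R n k.
elim: j => [|j [B B0 IH]].
  by exists 1 => // u v _ _; rewrite !expr0 subrr normr0 normr1 mul1r.
exists (A * 2 * B + A * B) => [|u v u2 v2].
  by rewrite addr_ge0 ?mulr_ge0.
have [mb mL] := IH u v u2 v2.
have lu : `|moment_form k u| <= A * 2 by apply: le_trans (Ale _) _; rewrite ler_wpM2l.
have lv : `|moment_form k v| <= A * 2 by apply: le_trans (Ale _) _; rewrite ler_wpM2l.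
split.
  rewrite exprS normrM; apply: (@le_trans _ _ (A * 2 * B)).
    by rewrite ler_pM.
  by rewrite lerDl mulr_ge0.
rewrite !exprS.
have -> : moment_form k u * moment_form k u ^+ j -
          moment_form k v * moment_form k v ^+ j =
          moment_form k v * (moment_form k u ^+ j - moment_form k v ^+ j) +
          moment_form k (u - v) * moment_form k u ^+ j.
  by rewrite moment_formB; ring.
apply: (le_trans (ler_normD _ _)); rewrite !normrM mulrDl.
apply: lerD.
  by rewrite -mulrA ler_pM.
by rewrite mulrAC ler_pM.
Qed.

Lemma ridge_poly_lipschitz (R : realType) K m n : exists2 A : R, 0 < A &
  forall (a : 'M[R]_(K, m)) (u v : 'rV[R]_n), `|u| <= 2 -> `|v| <= 2 ->
    `|ridge_poly a u| <= A * `|a| /\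
    `|ridge_poly a u - ridge_poly a v| <= A * `|a| * `|u - v|.
Proof.
have : forall kj : 'I_K * 'I_m, exists A : R, 0 <= A /\
  forall u v : 'rV[R]_n, `|u| <= 2 -> `|v| <= 2 ->
    `|moment_form kj.1 u ^+ kj.2| <= A /\
    `|moment_form kj.1 u ^+ kj.2 - moment_form kj.1 v ^+ kj.2| <= A * `|u - v|.
  move=> kj; have [A] := @moment_form_exp_lipschitz R n kj.1 kj.2.
  by exists A.
move=> /choice[B BP].
exists (1 + \sum_k \sum_j B (k, j)) => [|a u v u2 v2].
  by rewrite ltr_pwDl // sumr_ge0 // => k _; rewrite sumr_ge0 // => j _; apply: (BP _).1.
have BS (t : R) : 0 <= t ->
   \sum_k \sum_j t * B (k, j) <= (1 + \sum_k \sum_j B (k, j)) * t.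
  move=> t0; rewrite mulrDl mul1r mulrC mulr_sumr.
  by rewrite ler_wpDl //; apply: ler_sum => k _; rewrite mulr_sumr.
split.
  apply: le_trans (BS _ (normr_ge0 _)).
  apply: (le_trans (ler_norm_sum _ _ _)); apply: ler_sum => k _.
  apply: (le_trans (ler_norm_sum _ _ _)); apply: ler_sum => j _.
  rewrite normrM ler_pM ?mx_entry_le //.
  exact: (((BP (k, j)).2 u v u2 v2).1).
have := BS (`|a| * `|u - v|) (mulr_ge0 (normr_ge0 _) (normr_ge0 _)).
rewrite mulrA; apply: le_trans.
rewrite /ridge_poly -sumrB.
apply: (le_trans (ler_norm_sum _ _ _)); apply: ler_sum => k _; rewrite -sumrB.
apply: (le_trans (ler_norm_sum _ _ _)); apply: ler_sum => j _.
rewrite -mulrBr normrM -mulrA ler_pM ?mx_entry_le //.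
by rewrite mulrC; exact: (((BP (k, j)).2 u v u2 v2).2).
Qed.

Lemma horner_rVpoly_moment (R : realType) n (k : nat) (u : 'rV[R]_n) :
  (rVpoly u).[k%:R] = moment_form k u.
Proof.
rewrite (horner_coef_wide _ (size_poly _ _)) /moment_form.
by apply: eq_bigr => i _; rewrite coef_rVpoly_ord mulrC.
Qed.

(** The coordinates of [u] are the coefficients of a polynomial whose value at
    [k] is [moment_form k u].  The product of the polynomials of all differences
    of distinct points is nonzero of degree at most [m * m * n.+1], so one of
    its would-be roots [0, ..., K - 1] is not a root. *)
Lemma separating_moment_form (R : realType) K m n (theta : 'I_m -> 'rV[R]_n) :
  injective theta -> (m * m * n.+1 < K)%N ->
  exists k : 'I_K, injective (fun i => moment_form k (theta i)).
Proof.
move=> inj mK.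
pose F (ij : 'I_m * 'I_m) : {poly R} :=
  if ij.1 == ij.2 then 1 else rVpoly (theta ij.1 - theta ij.2).
have F0 : \prod_ij F ij != 0.
  rewrite prodf_seq_neq0; apply/allP => -[i j] _ /=; rewrite /F /=.
  have [_|ij] := eqVneq i j; first by rewrite oner_neq0.
  apply: contraNneq ij => r0; apply/eqP/inj/subr0_eq.
  by rewrite -(rVpolyK (theta i - theta j)) r0 linear0.
have sF : (size (\prod_ij F ij)%R <= (m * m * n.+1).+1)%N.
  apply: (leq_trans (size_prod_leq _ _)); rewrite (leq_trans (leq_subr _ _)) // ltnS.
  rewrite -[X in (_ <= X * X * _)%N]card_ord -card_prod -sum_nat_const.
  apply: leq_sum => -[i j] _; rewrite /F /=; case: ifP => _.
    by rewrite size_poly1.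
  exact: leq_trans (size_poly _ _) _.
apply: contrapT => nok.
pose rs : seq R := [seq (k : nat)%:R | k <- iota 0 K].
have : (size rs < size (\prod_ij F ij)%R)%N.
  apply: max_poly_roots => //; last first.
    by rewrite map_inj_uniq ?iota_uniq // => x y /eqP; rewrite eqr_nat => /eqP.
  apply/allP => _ /mapP[k + ->]; rewrite mem_iota add0n /= => kK.
  apply: contrapT => /negP nroot; apply: nok; exists (Ordinal kK) => i j /= ij.
  apply: contrapT => /eqP neq; move/negP: nroot; apply.
  rewrite /root horner_prod (bigD1 (i, j)) //= [F _]/F /= (negPf neq).
  by rewrite horner_rVpoly_moment moment_formB ij subrr mul0r.
rewrite size_map size_iota => /leq_trans /(_ sF).
by rewrite ltnS leqNgt mK.
Qed.

(** The constant is a bound for the inverse of the Vandermonde matrix. *)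
Lemma small_poly_coef (R : realType) m (tau : 'I_m -> R) : injective tau ->
  exists C : R, forall (b : 'I_m -> R) (t : R),
    (forall i, `|\sum_(j < m) b j * tau i ^+ j| <= t) -> forall j, `|b j| <= C * t.
Proof.
move=> inj; pose V := Vandermonde m (\row_i tau i).
have Vu : V \in unitmx.
  rewrite unitmxE det_Vandermonde unitfE prodf_seq_neq0; apply/allP => i _ /=.
  rewrite prodf_seq_neq0; apply/allP => j _ /=; apply/implyP => ij.
  rewrite !mxE subr_eq0; apply/eqP => /inj ji.
  by move: ij; rewrite ji ltnn.
exists (\sum_(j < m) \sum_(i < m) `|invmx V i j|) => b t bt j.
have -> : b j = \sum_i (\sum_(l < m) b l * tau i ^+ l) * invmx V i j.
  have -> : b j = (\row_l b l *m V *m invmx V) 0 j by rewrite mulmxK // mxE.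
  rewrite mxE; apply: eq_bigr => i _; congr (_ * _).
  by rewrite mxE; apply: eq_bigr => l _; rewrite !mxE.
apply: (le_trans (ler_norm_sum _ _ _)).
apply: (@le_trans _ _ (\sum_i `|invmx V i j| * t)).
  by apply: ler_sum => i _; rewrite normrM mulrC ler_wpM2l.
rewrite -mulr_suml ler_wpM2r //; first exact: le_trans (bt j).
rewrite [leRHS](bigD1 j) //= lerDl; apply: sumr_ge0 => l _.
by apply: sumr_ge0.
Qed.

(** * Radial perturbations of the ball *)

Definition norm_sq (R : realType) n (u : 'rV[R]_n) : R := \sum_(i < n) u 0 i ^+ 2.

(** For small [a] every ray from the origin is mapped to itself.  So the image of a
    unit vector [th] has Euclidean length [1 + ridge_poly a th], and both [th] and
    this length can be read off from it without solving an equation. *)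
Definition radial_map (R : realType) K m n (a : 'M[R]_(K, m)) (u : 'rV[R]_n) :=
  (1 + ridge_poly a u) *: u.

(** The bounds make [radial_map a] a perturbation of the identity by a map of
    Lipschitz constant at most 1/2 ([radial_map_near_id]). *)
Definition small_param (R : realType) K m n (a : 'M[R]_(K, m)) : Prop :=
  forall u v : 'rV[R]_n, `|u| <= 2 -> `|v| <= 2 ->
    `|ridge_poly a u| <= 1 / 6 /\
    `|ridge_poly a u - ridge_poly a v| <= 1 / 6 * `|u - v|.

Lemma small_paramP (R : realType) K m n : exists2 rho : R, 0 < rho &
  forall a : 'M[R]_(K, m), `|a| < rho -> small_param n a.
Proof.
have [A A0 Ale] := ridge_poly_lipschitz R K m n.
exists (1 / (6 * A)) => [|a]; first by rewrite divr_gt0 ?mulr_gt0.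
rewrite ltr_pdivlMr ?mulr_gt0 // => aA u v u2 v2.
have Aa : A * `|a| <= 1 / 6 by nra.
have [ub uv] := Ale a u v u2 v2; split; first exact: le_trans ub _.
by apply: (le_trans uv); rewrite ler_wpM2r.
Qed.

Lemma norm_sq_le1 (R : realType) n (u : 'rV[R]_n) : norm_sq u <= 1 -> `|u| <= 1.
Proof.
move=> u1; apply: mx_norm_le => // i j; rewrite ord1 {i}.
rewrite -(@ler_pXn2r _ 2) ?nnegrE // expr1n -normrX ger0_norm ?sqr_ge0 //.
apply: le_trans u1; rewrite /norm_sq (bigD1 j) //= lerDl.
by apply: sumr_ge0 => i _; rewrite sqr_ge0.
Qed.

Lemma radial_map_near_id (R : realType) K m n (a : 'M[R]_(K, m)) (u v : 'rV[R]_n) :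
  small_param n a -> `|u| <= 2 -> `|v| <= 2 ->
  `|(radial_map a u - radial_map a v) - (u - v)| <= 1 / 2 * `|u - v|.
Proof.
move=> sa u2 v2; have [ub uv] := sa u v u2 v2.
have -> : (radial_map a u - radial_map a v) - (u - v) =
  ridge_poly a u *: (u - v) + (ridge_poly a u - ridge_poly a v) *: v.
  by apply/matrixP => i j; rewrite !mxE; ring.
apply: (le_trans (ler_normD _ _)); rewrite !normrZ.
have := ler_wpM2r (normr_ge0 (u - v)) ub.
have := ler_pM (normr_ge0 _) (normr_ge0 _) uv v2.
lra.
Qed.

Lemma radial_map_expand (R : realType) K m n (a : 'M[R]_(K, m)) (u v : 'rV[R]_n) :
  small_param n a -> `|u| <= 2 -> `|v| <= 2 ->
  `|u - v| <= 2 * `|radial_map a u - radial_map a v|.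
Proof.
move=> sa u2 v2; have := radial_map_near_id sa u2 v2.
have := lerB_dist (u - v) (radial_map a u - radial_map a v).
rewrite [`|u - v - _|]distrC; lra.
Qed.

Lemma radial_map_bound (R : realType) K m n (a : 'M[R]_(K, m)) (u : 'rV[R]_n) :
  small_param n a -> `|u| <= 2 -> `|radial_map a u| <= 7 / 6 * `|u|.
Proof.
move=> sa u2; have [ub _] := sa u u u2 u2.
rewrite normrZ ler_wpM2r //; apply: (le_trans (ler_normD _ _)).
by rewrite normr1; lra.
Qed.

Lemma norm_sq_continuous (R : realType) n : continuous (@norm_sq R n).
Proof.
apply: continuous_big => [|i _]; first exact: add_continuous.
move=> u; apply: (@continuous_comp _ _ _ (fun w : 'rV[R]_n => w 0 i) (fun x => x ^+ 2)).
  exact: coord_continuous.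
exact: exprn_continuous.
Qed.

(** [radial_map a u = v] means that [u] is a fixed point of [u |-> v - (radial_map
    a u - u)], which contracts every small ball around [u0] into itself when [v]
    is close to [radial_map a u0]. *)
Lemma radial_map_open (R : realType) K m n (a : 'M[R]_(K, m)) (u0 : 'rV[R]_n) :
  small_param n a -> norm_sq u0 < 1 ->
  \forall v \near radial_map a u0, exists2 u, norm_sq u <= 1 & radial_map a u = v.
Proof.
move=> sa u01.
have u0n : `|u0| <= 1 by apply: norm_sq_le1; exact: ltW.
have : \forall u \near u0, norm_sq u < 1.
  exact: (@norm_sq_continuous _ _ u0 _ (lt_nbhsl u01)).
move=> /nbhs_ballP[e /= e0 sub].
pose kap := Num.min (e / 2) 1.
have k0 : 0 < kap by rewrite lt_min; apply/andP; split; lra.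
have ke : kap < e.
  by have := ge_min (e / 2) (e / 2) 1; rewrite lexx /= -/kap => ?; lra.
have k1 : kap <= 1 by rewrite ge_min lexx orbT.
apply/nbhs_ballP; exists (kap / 2) => [|v] /=; first by lra.
rewrite mx_norm_ball /ball_ /= => vk.
have in2 w : `|u0 - w| <= kap -> `|w| <= 2.
  move=> wk; have := ler_normB u0 (u0 - w); rewrite opprB addrC subrK; lra.
pose T w : 'rV[R]_n := v - (radial_map a w - w).
have TL w w' : `|w| <= 2 -> `|w'| <= 2 -> `|T w - T w'| <= 1 / 2 * `|w - w'|.
  move=> w2 w2'; apply: le_trans (radial_map_near_id sa w2 w2').
  rewrite -normrN le_eqVlt; apply/orP; left; apply/eqP; congr `|_|.
  by apply/matrixP => i j; rewrite !mxE; ring.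
have Tfun : set_fun (closed_ball u0 kap) (closed_ball u0 kap) T.
  move=> w; rewrite closed_ballE // /closed_ball_ /= => wk.
  have -> : u0 - T w = (radial_map a u0 - v) - (T w - T u0).
    by apply/matrixP => i j; rewrite !mxE; ring.
  apply: (le_trans (ler_normB _ _)).
  have := TL w u0 (in2 _ wk); rewrite [`|w - u0|]distrC => /(_ ltac:(lra)); lra.
have ctr : is_contraction (mkfun_fun Tfun).
  exists (1 / 2)%:nng; split; first by rewrite /=; lra.
  move=> [w w'] [/= ww ww']; apply: TL; apply: in2.
    by move: ww; rewrite closed_ballE.
  by move: ww'; rewrite closed_ballE.
have := @banach_fixed_point R 'rV[R]_n (closed_ball u0 kap) (mkfun_fun Tfun) ctr.
case; [exact: closed_ball_closed | by exists u0; exact: closed_ballxx | move=> w Uw wT].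
have wk : `|u0 - w| <= kap by move: Uw; rewrite closed_ballE.
exists w; first by apply/ltW/sub; rewrite mx_norm_ball /ball_ /=; lra.
have : w = T w by [].
rewrite /T opprB addrA => /eqP; rewrite -subr_eq0 => /eqP h.
apply/matrixP => i j; have := congr1 (fun M : 'rV[R]_n => M i j) h.
rewrite !mxE; lra.
Qed.

(** The parameters may differ: a point of the image of the unit sphere determines
    its direction [u] and its length [1 + ridge_poly a u] whatever the parameter
    is.  The length is the square root of the sum of the squares, and it stays
    away from 0. *)
Lemma radial_map_sphere_lipschitz (R : realType) K m n (a a' : 'M[R]_(K, m))
    (u u' : 'rV[R]_n) :
  small_param n a -> small_param n a' -> norm_sq u = 1 -> norm_sq u' = 1 ->
  `|ridge_poly a u - ridge_poly a' u'| <=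
     2 * n%:R * `|radial_map a u - radial_map a' u'| /\
  `|u - u'| <= (2 + 3 * n%:R) * `|radial_map a u - radial_map a' u'|.
Proof.
move=> sa sa' u1 u1'.
have un : `|u| <= 1 by apply: norm_sq_le1; rewrite u1.
have un' : `|u'| <= 1 by apply: norm_sq_le1; rewrite u1'.
have un2 : `|u| <= 2 by lra.
have un2' : `|u'| <= 2 by lra.
have := radial_map_bound sa un2; have := radial_map_bound sa' un2'.
have [/ler_normlP[q1 q2] _] := sa _ _ un2 un2.
have [/ler_normlP[q1' q2'] _] := sa' _ _ un2' un2'.
rewrite /radial_map; set q := ridge_poly a u in q1 q2 *.
set q' := ridge_poly a' u' in q1' q2' *.
set v := _ *: u; set v' := _ *: u' => vb' vb.
have nu2 (b : 'M[R]_(K, m)) w : norm_sq w = 1 ->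
    norm_sq ((1 + ridge_poly b w) *: w) = (1 + ridge_poly b w) ^+ 2.
  move=> w1; rewrite /norm_sq -[RHS]mulr1 -w1 mulr_sumr.
  by apply: eq_bigr => i _; rewrite mxE exprMn.
have dq : `|q - q'| <= 2 * n%:R * `|v - v'|.
  have : `|(1 + q) ^+ 2 - (1 + q') ^+ 2| <= n%:R * (7 / 3 * `|v - v'|).
    rewrite -!nu2 // -/v -/v' /norm_sq -sumrB.
    rewrite -[X in X%:R]card_ord mulr_natl -sumr_const.
    apply: (le_trans (ler_norm_sum _ _ _)); apply: ler_sum => i _.
    rewrite subr_sqr normrM mulrC ler_pM //.
      apply: (le_trans (ler_normD _ _)).
      have := mx_entry_le v 0 i; have := mx_entry_le v' 0 i; lra.
    by have := mx_entry_le (v - v') 0 i; rewrite !mxE.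
  rewrite subr_sqr normrM [`|_ + (1 + q')|]ger0_norm; last by lra.
  have -> : 1 + q - (1 + q') = q - q' by ring.
  have q53 : 5 / 3 <= 1 + q + (1 + q') by lra.
  have := ler_wpM2l (normr_ge0 (q - q')) q53.
  have : 0 <= n%:R * `|v - v'| by rewrite mulr_ge0.
  lra.
split => //.
have : (1 + q) *: (u - u') = (v - v') + (q' - q) *: u'.
  by apply/matrixP => i j; rewrite !mxE; ring.
move=> /(congr1 Num.norm); rewrite normrZ ger0_norm; last by lra.
have := ler_normD (v - v') ((q' - q) *: u'); rewrite normrZ [`|q' - q|]distrC.
have := ler_wpM2l (normr_ge0 (q - q')) un'.
have q56 : 5 / 6 <= 1 + q by lra.
have := ler_wpM2r (normr_ge0 (u - u')) q56.
have : 0 <= n%:R * `|v - v'| by rewrite mulr_ge0.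
have := normr_ge0 (v - v'); lra.
Qed.

(** If [v = radial_map a u] with [u] a unit vector, then [ridge_poly a u] is
    known up to a multiple of the error on [v].  For [m] vectors [u i] that are
    separated by the form of index [k], this gives the values of the polynomial
    with coefficients [a k _] at [m] points, up to the contribution of the other
    rows.  The constant [C] of [small_poly_coef] is a parameter, so that [D]
    does not depend on the vectors. *)
Lemma ridge_coef_stable (R : realType) K m n (C : R) : exists2 D : R, 0 <= D &
  forall (a a' : 'M[R]_(K, m)) (k : 'I_K) (u u' : 'I_m -> 'rV[R]_n) (t : R),
    small_param n a -> small_param n a' ->
    (forall i, norm_sq (u i) = 1) -> (forall i, norm_sq (u' i) = 1) ->
    (forall (b : 'I_m -> R) (s : R),
       (forall i, `|\sum_(j < m) b j * moment_form k (u i) ^+ j| <= s) ->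
       forall j, `|b j| <= C * s) ->
    (forall i, `|radial_map a (u i) - radial_map a' (u' i)| <= t) ->
    (forall k' j, k' != k -> `|a k' j - a' k' j| <= t) ->
    0 <= t -> `|a - a'| <= D * t.
Proof.
have [A A0 Ale] := ridge_poly_lipschitz R K m n.
pose E : R := 2 * n%:R + (2 + 3 * n%:R) + A.
have E0 : 0 <= E by rewrite /E !addr_ge0 ?mulr_ge0 // ltW.
exists (1 + `|C| * E) => [|a a' k u u' t sa sa' u1 u1' Cle radt off t0].
  by rewrite addr_ge0 ?mulr_ge0.
(* the difference of the parameters, with row [k] erased *)
pose a2 : 'M[R]_(K, m) := \matrix_(i, j) (if i == k then 0 else a i j - a' i j).
have a2t : `|a2| <= t.
  apply: mx_norm_le => // i j; rewrite mxE; case: ifPn => [_|/off]; last exact.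
  by rewrite normr0.
have rowk i : `|\sum_(j < m) (a - a') k j * moment_form k (u i) ^+ j| <= E * t.
  have -> : \sum_(j < m) (a - a') k j * moment_form k (u i) ^+ j =
      ridge_poly (a - a') (u i) - ridge_poly a2 (u i).
    rewrite -ridge_polyB /ridge_poly (bigD1 k) //= [X in _ = _ + X]big1 ?addr0.
      by apply: eq_bigr => j _; rewrite !mxE eqxx subr0.
    move=> l lk; rewrite big1 // => j _; rewrite !mxE (negPf lk).
    by rewrite subrr mul0r.
  have un : `|u i| <= 2.
    by have := @norm_sq_le1 _ _ (u i); rewrite u1 => /(_ (lexx _)); lra.
  have un' : `|u' i| <= 2.
    by have := @norm_sq_le1 _ _ (u' i); rewrite u1' => /(_ (lexx _)); lra.
  have [l1 l2] := radial_map_sphere_lipschitz sa sa' (u1 i) (u1' i).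
  have [_ l3] := sa' _ _ un' un.
  have [l4 _] := Ale a2 _ _ un un.
  have l5 := ler_wpM2l (ltW A0) a2t.
  rewrite ridge_polyB.
  have -> : ridge_poly a (u i) - ridge_poly a' (u i) - ridge_poly a2 (u i) =
    (ridge_poly a (u i) - ridge_poly a' (u' i)) +
    (ridge_poly a' (u' i) - ridge_poly a' (u i)) - ridge_poly a2 (u i) by ring.
  apply: (le_trans (ler_normB _ _)); apply: (le_trans (lerD (ler_normD _ _) (lexx _))).
  have n0 : 0 <= n%:R :> R by rewrite ler0n.
  have l6 := ler_wpM2l n0 (radt i).
  rewrite [`|u' i - u i|]distrC in l3.
  have l7 : 0 <= n%:R * t by rewrite mulr_ge0.
  have := normr_ge0 (u i - u' i); have := radt i; rewrite /E; lra.
have coefk j := Cle _ _ rowk j.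
apply: mx_norm_le => [|i j]; first by rewrite mulr_ge0 // addr_ge0 // mulr_ge0.
have CE : C * (E * t) <= `|C| * E * t by rewrite mulrA ler_wpM2r // ler_wpM2r // ler_norm.
rewrite mulrDl mul1r; have [->|ik] := eqVneq i k.
  by have := coefk j; lra.
have := off i j ik; rewrite !mxE; have : 0 <= `|C| * E * t by rewrite !mulr_ge0.
lra.
Qed.

(** * Strict differentiability *)

(** The mean value theorem for each coordinate along the segment from [q] to [p]. *)
Lemma segment_mean_value (R : realType) (V : normedModType R) m (g : V -> 'rV[R]_m)
    (p q : V) (y : 'rV[R]_m) (e : R) : 0 <= e ->
  (forall s : R, 0 <= s <= 1 -> differentiable g (q + s *: (p - q))) ->
  (forall s : R, 0 <= s <= 1 -> `|'d g (q + s *: (p - q)) (p - q) - y| <= e) ->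
  `|g p - g q - y| <= e.
Proof.
move=> e0 dg dge; set w := p - q in dg dge.
pose gam (s : R) := g (q + s *: w).
have dgam (s : R) : 0 <= s <= 1 -> differentiable gam s /\ 'D_1 gam s = 'd g (q + s *: w) w.
  move=> s01.
  have dl : is_diff s (fun s : R => q + s *: w) ( *:%R^~ w).
    have -> : (fun s : R => q + s *: w) = cst q + ( *:%R^~ w) by apply/funext.
    by apply: is_diff_eq; rewrite add0r.
  have dg1 : is_diff (q + s *: w) g ('d g (q + s *: w)).
    exact: differentiableP (dg s s01).
  have dc : is_diff s gam ('d g (q + s *: w) \o ( *:%R^~ w)).
    exact: (is_diff_comp dl dg1).
  have dd : differentiable gam s by [].
  split=> //; rewrite deriveE // diff_val /= scale1r //.
apply: mx_norm_le => // i j; rewrite ord1 {i}.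
pose chi (s : R) := gam s 0 j - s * y 0 j.
have dchi (s : R) : 0 <= s <= 1 -> is_derive s 1 chi (('d g (q + s *: w) w - y) 0 j).
  move=> s01; have [dd de] := dgam s s01.
  have dv : derivable gam s 1 by exact: diff_derivable.
  have /derivable_mxP /(_ 0 j) dj := dv.
  have dj' : is_derive s 1 (fun s => gam s 0 j) ('D_1 gam s 0 j).
    by rewrite (derive_mx dv) mxE; exact: derivableP.
  have -> : chi = (fun s => gam s 0 j) - (y 0 j *: id).
    by apply/funext => z; rewrite /chi !fctE /= mulrC.
  apply: is_derive_eq; rewrite !mxE de; congr (_ - _).
  by rewrite /GRing.scale /= mulr1.
have [||c c01 ce] := @MVT R chi (fun s => ('d g (q + s *: w) w - y) 0 j) 0 1 ltr01.
- move=> s; rewrite in_itv /= => /andP[s0 s1]; apply: dchi; lra.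
- apply: derivable_within_continuous => s; rewrite in_itv /= => s01.
  by have [] := dchi s s01.
have c01' : 0 <= c <= 1 by move: c01; rewrite in_itv /= => /andP[]; lra.
have -> : (g p - g q - y) 0 j = chi 1 - chi 0.
  have qw : q + w = p by rewrite /w addrC subrK.
  by rewrite /chi /gam scale1r scale0r addr0 qw !mxE; ring.
rewrite ce subr0 mulr1.
exact: le_trans (mx_entry_le _ _ _) (dge c c01').
Qed.

(** Both points vary.  This is what makes local bounds on difference quotients
    follow from bounds on the linear map [L]. *)
Definition strict_diff (R : realType) (V W : normedModType R) (g : V -> W)
    (p0 : V) (L : V -> W) : Prop :=
  forall e : R, 0 < e -> exists2 del : R, 0 < del &
    forall p q, `|p - p0| < del -> `|q - p0| < del ->
      `|g p - g q - L (p - q)| <= e * `|p - q|.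

(** Finite dimension, in the form in which it is used: coordinates dominated by
    the norm. *)
Definition finite_frame (R : realType) (V : normedModType R) : Prop :=
  exists (I : finType) (e : I -> V) (kap : V -> I -> R),
    forall v, v = \sum_i kap v i *: e i /\ forall i, `|kap v i| <= `|v|.

Lemma finite_frame_rV (R : realType) n : finite_frame 'rV[R]_n.
Proof.
exists 'I_n, (fun i => delta_mx 0 i), (fun (v : 'rV[R]_n) i => v 0 i) => v.
by split=> [|i]; [exact: row_sum_delta | exact: mx_entry_le].
Qed.

Lemma finite_frame_prod (R : realType) (V : normedModType R) :
  finite_frame V -> finite_frame (R * V)%type.
Proof.
move=> [I [e [kap P]]].
exists (option I), (fun i => if i is Some i then (0, e i) else (1, 0) : R * V),
  (fun (v : R * V) i => if i is Some i then kap v.2 i else v.1) => -[t v].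
split=> [|[i|]] /=.
- have vE := (P v).1; rewrite (eq_bigr (fun i => if i is Some i then
     (0, kap v i *: e i) else (t, 0) : R * V)); last first.
    by case=> [i|] _; congr pair; rewrite ?scaler0 // /GRing.scale /= mulr1.
  rewrite [RHS]surjective_pairing (raddf_sum fst) (raddf_sum snd) /=; congr pair.
    by rewrite (bigD1 None) //= big1 ?addr0 // => -[].
  rewrite (bigD1 None) //= add0r {1}vE (reindex_omap Some id) //=; last by case.
  by apply: eq_bigl => i; rewrite eqxx.
- by rewrite (le_trans ((P v).2 i)) // prod_normE /= le_max lexx orbT.
- by rewrite prod_normE /= le_max lexx.
Qed.

(** The differential is a combination of finitely many directional derivatives,
    so it is continuous at [p0] in the operator norm; the mean value inequality
    on a small ball concludes. *)
Lemma C1_strict_diff (R : realType) (V : normedModType R) m (U : set V)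
    (g : V -> 'rV[R]_m) (p0 : V) :
  finite_frame V -> nbhs p0 U -> Ck 1 U g -> strict_diff g p0 ('d g p0).
Proof.
move=> [I [b [kap kapP]]] Up0 [dg cD] e e0.
pose e' := e / (#|I|.+1)%:R.
have e'0 : 0 < e' by rewrite divr_gt0.
have : \forall p \near p0, U p /\ forall i, `|'D_(b i) g p - 'D_(b i) g p0| < e'.
  apply: filterI => //; apply: filter_forall => i.
  have /cvgrPdist_lt /(_ _ e'0) := cD (b i) p0 (nbhs_singleton Up0).
  by apply: filterS => x /=; rewrite distrC.
move=> /nbhs_ballP[del /= del0 sub]; exists del => // p q pd qd.
have near_seg (s : R) : 0 <= s <= 1 -> ball p0 del (q + s *: (p - q)).
  move=> /andP[s0 s1]; rewrite -ball_normE /ball_ /= distrC.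
  have -> : q + s *: (p - q) - p0 = s *: (p - p0) + (1 - s) *: (q - p0).
    rewrite scalerBl scale1r addrCA -scalerBr opprB addrA subrK.
    by rewrite addrAC.
  apply: (le_lt_trans (ler_normD _ _)).
  rewrite !normrZ (ger0_norm s0) ger0_norm ?subr_ge0 //.
  have [s00|s00] := eqVneq s 0; first by rewrite s00; lra.
  have sp : 0 < s by rewrite lt_neqAle eq_sym s00.
  have : s * `|p - p0| < s * del by rewrite ltr_pM2l.
  have : (1 - s) * `|q - p0| <= (1 - s) * del by rewrite ler_wpM2l ?subr_ge0 // ltW.
  lra.
have dgs (s : R) : 0 <= s <= 1 -> differentiable g (q + s *: (p - q)).
  by move=> /near_seg /sub[Us _]; exact: dg.
apply: segment_mean_value => // [|s s01]; first by rewrite mulr_ge0 ?(ltW e0).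
have dE r w : differentiable g r -> 'd g r w = \sum_i kap w i *: 'D_(b i) g r.
  move=> dr; rewrite {1}(kapP w).1 linear_sum; apply: eq_bigr => i _.
  by rewrite linearZ deriveE.
have dg0 := dg _ (nbhs_singleton Up0).
rewrite (dE _ _ (dgs _ s01)) (dE _ _ dg0).
rewrite -sumrB; apply: (le_trans (ler_norm_sum _ _ _)).
apply: (@le_trans _ _ (\sum_(i : I) e' * `|p - q|)).
  apply: ler_sum => i _; rewrite -scalerBr normrZ mulrC ler_pM ?(kapP _).2 //.
  by apply/ltW; have [_] := sub _ (near_seg s s01); apply.
rewrite sumr_const -mulr_natl mulrA ler_wpM2r //.
rewrite /e' mulrCA ler_piMr ?(ltW e0) //.
by rewrite ler_pdivrMr // mul1r ler_nat.
Qed.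

Lemma strict_diff_near_eq (R : realType) (V W : normedModType R) (g h : V -> W)
    (p0 : V) (L : V -> W) :
  (\forall p \near p0, g p = h p) -> strict_diff g p0 L -> strict_diff h p0 L.
Proof.
move=> /nbhs_ballP[r /= r0 gh] sd e e0; have [d d0 dP] := sd e e0.
exists (Num.min r d) => [|p q]; first by rewrite lt_min r0.
rewrite !lt_min => /andP[pr pd] /andP[qr qd].
by rewrite -!gh; [exact: dP | |]; rewrite -ball_normE /ball_ /= distrC.
Qed.

Lemma strict_diff_lipschitz (R : realType) (V W : normedModType R) (g : V -> W)
    (p0 : V) (L : V -> W) (k : R) :
  strict_diff g p0 L -> (forall v, `|L v| <= k * `|v|) ->
  exists2 del : R, 0 < del & forall p q, `|p - p0| < del -> `|q - p0| < del ->
    `|g p - g q| <= (k + 1) * `|p - q|.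
Proof.
move=> sd Lk; have [d d0 dP] := sd 1 ltr01; exists d => // p q pd qd.
have := dP p q pd qd; have := Lk (p - q).
have := ler_normD (g p - g q - L (p - q)) (L (p - q)); rewrite subrK; lra.
Qed.

Lemma strict_diff_expand (R : realType) (V W : normedModType R) (g : V -> W)
    (p0 : V) (L : V -> W) (k : R) : 0 < k ->
  strict_diff g p0 L -> (forall v, `|v| <= k * `|L v|) ->
  exists2 del : R, 0 < del & forall p q, `|p - p0| < del -> `|q - p0| < del ->
    `|p - q| <= 2 * k * `|g p - g q|.
Proof.
move=> k0 sd Lk; have e0 : 0 < (2 * k)^-1 by rewrite invr_gt0 mulr_gt0.
have [d d0 dP] := sd _ e0; exists d => // p q pd qd.
have h1 := dP p q pd qd; have h2 := Lk (p - q).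
have h3 := lerB_dist (L (p - q)) (g p - g q); rewrite distrC in h3.
have h4 : `|p - q| <= k * (`|g p - g q| + (2 * k)^-1 * `|p - q|).
  by apply: (le_trans h2); rewrite ler_wpM2l ?(ltW k0) //; lra.
have h5 : k * (`|g p - g q| + (2 * k)^-1 * `|p - q|) =
          k * `|g p - g q| + `|p - q| / 2 by field; rewrite gt_eqF.
lra.
Qed.

Lemma strict_diff_comp (R : realType) (V W Z : normedModType R) (f : V -> W)
    (g : W -> Z) (p0 : V) (Lf : V -> W) (Lg : W -> Z) (kf kg : R) :
  (forall v, `|Lf v| <= kf * `|v|) ->
  (forall v w, Lg (v - w) = Lg v - Lg w) -> (forall w, `|Lg w| <= kg * `|w|) ->
  strict_diff f p0 Lf -> strict_diff g (f p0) Lg ->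
  strict_diff (g \o f) p0 (Lg \o Lf).
Proof.
move=> kfP LgB kgP sf sg e e0.
have [d1 d10 lipf] := strict_diff_lipschitz sf kfP.
pose k := `|kf| + 1 + `|kg| + 1.
have k0 : 0 < k by rewrite /k; have := normr_ge0 kf; have := normr_ge0 kg; lra.
have ek : 0 < e / (2 * k) by rewrite divr_gt0 // mulr_gt0.
have [d2 d20 f2] := sf _ ek; have [d3 d30 g3] := sg _ ek.
pose d := Num.min d1 (Num.min d2 (d3 / k)).
have dd0 : 0 < d by rewrite /d !lt_min d10 d20 divr_gt0.
exists d => // p q; rewrite !lt_min => /and3P[p1 p2 p3] /and3P[q1 q2 q3].
have p0d : `|p0 - p0| < d1 by rewrite subrr normr0.
have kfk : kf + 1 <= k.
  by rewrite /k; have := ler_norm kf; have := normr_ge0 kg; lra.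
have fin x : `|x - p0| < d1 -> `|x - p0| < d3 / k -> `|f x - f p0| < d3.
  move=> x1; rewrite ltr_pdivlMr // => x3.
  apply: (le_lt_trans (lipf _ _ x1 p0d)); apply: le_lt_trans x3.
  by rewrite mulrC ler_wpM2l.
have h1 := g3 _ _ (fin p p1 p3) (fin q q1 q3).
have h2 := f2 _ _ p2 q2; have h3 := lipf _ _ p1 q1.
have h4 := kgP (f p - f q - Lf (p - q)); rewrite LgB in h4.
have h5 : `|g (f p) - g (f q) - Lg (Lf (p - q))| <=
    `|g (f p) - g (f q) - Lg (f p - f q)| + `|Lg (f p - f q) - Lg (Lf (p - q))|.
  rewrite -[X in `|X| <= _](subrKA (Lg (f p - f q))).
  exact: ler_normD.
have n0 := normr_ge0 (p - q).
have h6 : kg * `|f p - f q - Lf (p - q)| <= `|kg| * (e / (2 * k) * `|p - q|).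
  apply: (@le_trans _ _ (`|kg| * `|f p - f q - Lf (p - q)|)).
    by rewrite ler_wpM2r // ler_norm.
  by rewrite ler_wpM2l.
have h7 : e / (2 * k) * `|f p - f q| <= e / (2 * k) * ((kf + 1) * `|p - q|).
  by rewrite ler_wpM2l // ltW.
have h8 : e / (2 * k) * ((kf + 1) * `|p - q|) + `|kg| * (e / (2 * k) * `|p - q|) =
   (kf + 1 + `|kg|) * (e / (2 * k) * `|p - q|) by ring.
have h9 : (kf + 1 + `|kg|) * (e / (2 * k) * `|p - q|) <=
    k * (e / (2 * k) * `|p - q|).
  rewrite ler_wpM2r //; first by rewrite mulr_ge0 // ltW.
  by rewrite /k; have := ler_norm kf; lra.
have h10 : k * (e / (2 * k) * `|p - q|) = e * `|p - q| / 2 by field; rewrite gt_eqF.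
have := mulr_ge0 (ltW e0) n0; rewrite /=; lra.
Qed.

Lemma strict_diff_pair (R : realType) (V W : normedModType R) (f : V -> W)
    (t0 : R) (p0 : V) (L : V -> W) :
  strict_diff f p0 L ->
  strict_diff (fun x : R * V => (x.1, f x.2)) (t0, p0) (fun x => (x.1, L x.2)).
Proof.
move=> sf e e0; have [d d0 dP] := sf e e0; exists d => // -[s p] [t q].
rewrite !prod_normE /= !gt_max => /andP[_ pd] /andP[_ qd].
have n0 : 0 <= e * Num.max `|s - t| `|p - q|.
  by rewrite mulr_ge0 ?(ltW e0) // le_max normr_ge0.
rewrite subrr normr0 ge_max n0 /=.
apply: (le_trans (dP _ _ pd qd)); rewrite ler_wpM2l ?(ltW e0) //.
by rewrite le_max lexx orbT.
Qed.

Lemma diff_bounded (R : realType) (V W : normedModType R) (g : V -> W) (p : V) :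
  differentiable g p -> exists2 k : R, 0 < k & forall v, `|'d g p v| <= k * `|v|.
Proof.
by move=> dg; apply: linear_lipschitz; exact: diff_continuous.
Qed.

(** * The flow in charts and its transition maps *)

Lemma Ck_into_lower (R : realType) d (X : topologicalType) (A : set (chart R d X))
    (V : normedModType R) (U : set V) (f : V -> X) :
  Ck_into A 2 U f -> Ck_into A 1 U f.
Proof.
move=> [fc fC]; split=> // c Ac; have [df dD] := fC c Ac.
split=> // v x Ux; have [dd _] := dD v.
exact: differentiable_continuous (dd x Ux).
Qed.

Lemma Ck_into_strict_diff (R : realType) d (X : topologicalType)
    (A : set (chart R d X)) (V : normedModType R) (U : set V) (f : V -> X)
    (c : chart R d X) (u : V) :
  finite_frame V -> Ck_into A 1 U f -> A c -> nbhs u U -> chart_dom c (f u) ->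
  differentiable (chart_map c \o f) u /\
  strict_diff (chart_map c \o f) u ('d (chart_map c \o f) u).
Proof.
move=> fV [fc fC] Ac uU cu.
have Uu := nbhs_singleton uU.
have nU : nbhs u (U `&` f @^-1` chart_dom c).
  apply: filterI => //; apply: (fc u Uu).
  by apply: open_nbhs_nbhs; split=> //; exact: chart_dom_open.
split; first by have [df _] := fC c Ac; apply: df.
exact: C1_strict_diff nU (fC c Ac).
Qed.

Definition flow_in_charts (R : realType) d (X : topologicalType)
    (phi : R -> X -> X) (c c' : chart R d X) (p : R * 'rV[R]_d) : 'rV[R]_d :=
  chart_map c' (phi p.1 (chart_inv c p.2)).

Lemma flow_in_charts_strict_diff (R : realType) d (X : topologicalType)
    (A : set (chart R d X)) (phi : R -> X -> X) (c c' : chart R d X) t w :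
  Ck_flow 2 A phi -> A c -> A c' -> chart_cod c w ->
  chart_dom c' (phi t (chart_inv c w)) ->
  differentiable (flow_in_charts phi c c') (t, w) /\
  strict_diff (flow_in_charts phi c c') (t, w) ('d (flow_in_charts phi c c') (t, w)).
Proof.
move=> [_ _ fC] Ac Ac' cw c'w.
apply: (@Ck_into_strict_diff _ _ _ A _ [set p | chart_cod c p.2]
  (fun p : R * 'rV[R]_d => phi p.1 (chart_inv c p.2))) => //.
- exact/finite_frame_prod/finite_frame_rV.
- exact/Ck_into_lower/fC.
- have : nbhs w (chart_cod c).
    by apply: open_nbhs_nbhs; split=> //; exact: chart_cod_open.
  exact: (@cvg_snd _ _ (nbhs t) (nbhs w)).
Qed.

Lemma flow_disc_strict_diff (R : realType) d n (X : topologicalType)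
    (A : set (chart R d X)) (phi : R -> X -> X) (c c' : chart R d X)
    (U : set 'rV[R]_n) (f : 'rV[R]_n -> X) (t : R) (u : 'rV[R]_n) :
  Ck_flow 2 A phi -> A c -> A c' -> Ck_into A 1 U f -> nbhs u U ->
  chart_dom c (f u) -> chart_dom c' (phi t (f u)) ->
  let L (z : R * 'rV[R]_n) :=
    'd (flow_in_charts phi c c') (t, chart_map c (f u))
      (z.1, 'd (chart_map c \o f) u z.2) in
  strict_diff (fun p : R * 'rV[R]_n => chart_map c' (phi p.1 (f p.2))) (t, u) L /\
  exists k : R, forall z, `|L z| <= k * `|z|.
Proof.
move=> flow Ac Ac' fC uU cu c'u L.
have [df sf] := Ck_into_strict_diff (@finite_frame_rV R n) fC Ac uU cu.
have cw : chart_cod c (chart_map c (f u)) by exact: chart_map_cod.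
have c'w : chart_dom c' (phi t (chart_inv c (chart_map c (f u)))) by rewrite chart_mapK.
have [dF sF] := flow_in_charts_strict_diff flow Ac Ac' cw c'w.
have [kf kf0 kfP] := diff_bounded df; have [kF kF0 kFP] := diff_bounded dF.
pose Lf (z : R * 'rV[R]_n) := (z.1, 'd (chart_map c \o f) u z.2).
have LfP z : `|Lf z| <= (1 + kf) * `|z|.
  case: z => s v; rewrite !prod_normE /= ge_max.
  set M := Num.max _ _.
  have sM : `|s| <= M by rewrite le_max lexx.
  have vM : `|v| <= M by rewrite le_max lexx orbT.
  have M0 : 0 <= M by apply: le_trans sM.
  have := kfP v; have := ler_wpM2l (ltW kf0) vM; have := mulr_ge0 (ltW kf0) M0.
  by move=> *; apply/andP; split; lra.
split; last first.
  exists (kF * (1 + kf)) => z; rewrite -mulrA; apply: (le_trans (kFP _)).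
  by rewrite ler_wpM2l ?(ltW kF0) // LfP.
have sLf := strict_diff_pair t sf.
have FB v w : 'd (flow_in_charts phi c c') (t, chart_map c (f u)) (v - w) =
    'd (flow_in_charts phi c c') (t, chart_map c (f u)) v -
    'd (flow_in_charts phi c c') (t, chart_map c (f u)) w by rewrite linearB.
apply: strict_diff_near_eq (strict_diff_comp LfP FB kFP sLf sF).
have : nbhs u (f @^-1` chart_dom c).
  apply: (fC.1 u (nbhs_singleton uU)).
  by apply: open_nbhs_nbhs; split=> //; exact: chart_dom_open.
move=> fcn; have : nbhs (t, u) (snd @^-1` (f @^-1` chart_dom c)) by exact: cvg_snd fcn.
by apply: filterS => -[s v] /= cv; rewrite /flow_in_charts /= chart_mapK.
Qed.

(** At time 0 the flow is the identity in space, and its derivative in time is by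
    definition the generating vector field. *)
Lemma diff_flow_at_time0 (R : realType) d (X : topologicalType)
    (A : set (chart R d X)) (phi : R -> X -> X) (c : chart R d X) y s v :
  Ck_flow 2 A phi -> A c -> chart_dom c y ->
  'd (flow_in_charts phi c c) (0, chart_map c y) (s, v) = s *: generator phi c y + v.
Proof.
move=> flow Ac cy; have [[f0 _] _ _] := flow.
set w := chart_map c y.
have cw : chart_cod c w by exact: chart_map_cod.
have cw0 : chart_dom c (phi 0 (chart_inv c w)) by rewrite f0; exact: chart_inv_dom.
have [dF sF] := flow_in_charts_strict_diff flow Ac Ac cw cw0.
have -> : (s, v) = s *: (1, 0) + (0, v).
  by congr pair; rewrite /= ?scaler0 ?add0r ?addr0 // /GRing.scale /= mulr1.
rewrite linearD linearZ /=; congr (_ *: _ + _).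
  rewrite -deriveE // /generator derive1E /derive.
  pose F := flow_in_charts phi c c.
  pose G (t : R) := chart_map c (phi t y).
  have FG : (fun h : R => h^-1 *: ((F \o shift (0, w)) (h *: (1, 0)) - F (0, w))) =
            (fun h : R => h^-1 *: ((G \o shift 0) (h *: 1) - G 0)).
    apply/funext => h; rewrite /F /G /flow_in_charts /= scaler0 add0r.
    by rewrite chart_mapK.
  exact: (congr1 (fun g : R -> 'rV[R]_d => lim (g @ 0^')) FG).
set z := 'd _ _ _; apply/eqP; rewrite eq_sym -subr_eq0 -normr_eq0 eq_le normr_ge0 andbT.
(* At time 0 the map is the identity in space, so [v] and its image [z] under
   the differential differ by less than any positive multiple of [`|v|]. *)
rewrite leNgt; apply/negP => m0; set m := `|v - z| in m0.
have v1 : 0 < `|v| + 1 by rewrite ltr_wpDl.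
have e0 : 0 < m / (2 * (`|v| + 1)) by rewrite divr_gt0 // mulr_gt0.
have [del del0 dP] := sF _ e0.
have : nbhs w (chart_cod c) by apply: open_nbhs_nbhs; split=> //; exact: chart_cod_open.
move=> /nbhs_ballP[r /= r0 sub].
pose h := Num.min del r / (2 * (`|v| + 1)).
have h0 : 0 < h by rewrite divr_gt0 ?mulr_gt0 // lt_min del0.
have hv : h * `|v| < Num.min del r.
  rewrite /h -mulrA gtr_pMr; last by rewrite lt_min del0.
  by rewrite mulrC ltr_pdivrMr ?mulr_gt0 //; lra.
move: hv; rewrite lt_min => /andP[hd hr].
have cwh : chart_cod c (w + h *: v).
  apply: sub; rewrite mx_norm_ball /ball_ /= opprD addrA subrr add0r normrN.
  by rewrite normrZ gtr0_norm.
have pE : (0, w + h *: v) - (0, w) = h *: (0, v) :> R * 'rV[R]_d.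
  by congr pair; rewrite /= ?scaler0 ?subrr // addrAC subrr add0r.
have pn : `|(0, w + h *: v) - (0, w) : R * 'rV[R]_d| = h * `|v|.
  rewrite pE prod_normE /= scaler0 normr0 normrZ gtr0_norm //.
  by apply/max_idPr; rewrite mulr_ge0 // ltW.
have qn : `|(0, w) - (0, w) : R * 'rV[R]_d| < del.
  by rewrite prod_normE /= !subrr !normr0 maxxx.
have pd : `|(0, w + h *: v) - (0, w) : R * 'rV[R]_d| < del by rewrite pn.
have := dP (0, w + h *: v) (0, w) pd qn.
rewrite pn pE.
rewrite {1 2}/flow_in_charts /= !f0 !chart_invK //.
rewrite linearZ /= [w + _ - w]addrAC subrr add0r -scalerBr normrZ (gtr0_norm h0) -/m.
rewrite mulrCA ler_pM2l // -mulrA ler_pMr // mulrC ler_pdivlMr ?mulr_gt0 //.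
have := normr_ge0 v; lra.
Qed.

(** The map [(a, v) |-> a *: gen + L v] is onto between spaces of the same
    dimension [n.+1], hence it is invertible. *)
Lemma transverse_splitting_bound (R : realType) n (gen : 'rV[R]_n.+1)
    (L : {linear 'rV[R]_n -> 'rV[R]_n.+1}) :
  (forall w, exists (a : R) v, w = a *: gen + L v) ->
  exists2 k : R, 0 < k &
    forall z : R * 'rV[R]_n, `|z| <= k * `|z.1 *: gen + L z.2|.
Proof.
move=> span.
pose M : 'M[R]_(1 + n, n.+1) := col_mx gen (lin1_mx L).
have ME a v : row_mx a%:M v *m M = a *: gen + L v.
  by rewrite mul_row_col mul_scalar_mx mul_rV_lin1.
have /choice[N NP] : forall i : 'I_n.+1, exists r : 'rV[R]_(1 + n),
    r *m M = delta_mx 0 i.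
  by move=> i; have [a [v ->]] := span (delta_mx 0 i); exists (row_mx a%:M v).
pose B : 'M[R]_(1 + n) := \matrix_(i < n.+1) N i.
have BM : B *m (M : 'M[R]_(1 + n)) = 1%:M.
  by apply/row_matrixP => i; rewrite row_mul rowK NP rowE mulmx1.
have MB : (M : 'M[R]_(1 + n)) *m B = 1%:M by exact: mulmx1C.
pose k := 1 + \sum_i \sum_j `|B i j|.
exists k => [|[a v]].
  by rewrite ltr_pwDl // sumr_ge0 // => i _; rewrite sumr_ge0.
rewrite -ME /=; set y : 'rV[R]_(1 + n) := _ *m M.
have yB : row_mx a%:M v = y *m B by rewrite /y -mulmxA MB mulmx1.
have yk j : `|(y *m B) 0 j| <= k * `|y|.
  rewrite mxE; apply: (le_trans (ler_norm_sum _ _ _)).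
  apply: (@le_trans _ _ (\sum_i `|y| * `|B i j|)).
    by apply: ler_sum => i _; rewrite normrM ler_wpM2r // mx_entry_le.
  rewrite -mulr_sumr mulrC ler_wpM2r // /k ler_wpDl //.
  apply: ler_sum => i _; rewrite (bigD1 j) //= lerDl; exact: sumr_ge0.
have k0 : 0 <= k * `|y| by exact: le_trans (yk 0).
rewrite prod_normE /= ge_max; apply/andP; split.
  by have := yk (lshift n 0); rewrite -yB row_mxEl mxE eqxx mulr1n.
apply: mx_norm_le => // i j; rewrite ord1.
by have := yk (rshift 1 j); rewrite -yB row_mxEr.
Qed.

(** Transversality at [u0] bounds the differential of [(s, u) |-> phi_s(f u)] at
    [(0, u0)] from below, and strict differentiability turns this into a lower
    bound for the map itself.  In particular the map is injective near [(0, u0)],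
    also when [u0] is a boundary point of the disc. *)
Lemma flow_box_expand (R : realType) n (X : topologicalType)
    (A : set (chart R n.+1 X)) (phi : R -> X -> X) (c : chart R n.+1 X)
    (U : set 'rV[R]_n) (f : 'rV[R]_n -> X) (u0 : 'rV[R]_n) :
  Ck_flow 2 A phi -> A c -> Ck_into A 1 U f -> nbhs u0 U -> chart_dom c (f u0) ->
  (forall w, exists (a : R) v,
     w = a *: generator phi c (f u0) + 'd (chart_map c \o f) u0 v) ->
  exists C del : R, [/\ 0 <= C, 0 < del & forall (s s' : R) (u u' : 'rV[R]_n),
    `|s| < del -> `|s'| < del -> `|u - u0| < del -> `|u' - u0| < del ->
    `|u - u'| <= C * `|chart_map c (phi s (f u)) - chart_map c (phi s' (f u'))|].
Proof.
move=> flow Ac fC uU cu span; have [[f0 _] _ _] := flow.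
have cu0 : chart_dom c (phi 0 (f u0)) by rewrite f0.
have [sd _] := flow_disc_strict_diff flow Ac Ac fC uU cu cu0.
have [k k0 kP] := transverse_splitting_bound span.
have LP (z : R * 'rV[R]_n) : `|z| <= k *
    `|'d (flow_in_charts phi c c) (0, chart_map c (f u0))
       (z.1, 'd (chart_map c \o f) u0 z.2)|.
  by rewrite (diff_flow_at_time0 _ _ flow Ac cu).
have [del del0 dP] := strict_diff_expand k0 sd LP.
exists (2 * k), del; split=> //; first by rewrite mulr_ge0 // ltW.
move=> s s' u u' sd1 sd1' ud ud'.
have nP (x : R) (y : 'rV[R]_n) : `|x| < del -> `|y - u0| < del ->
    `|(x, y) - (0, u0) : R * 'rV[R]_n| < del.
  by move=> xd yd; rewrite prod_normE /= subr0 gt_max xd.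
apply: le_trans (dP (s, u) (s', u') (nP _ _ sd1 ud) (nP _ _ sd1' ud')).
by rewrite prod_normE /= le_max lexx orbT.
Qed.

(** Since [phi_t (f u) = f v] amounts to [phi_t0 (f u) = phi_(t0 - t) (f v)], the
    left-hand side is Lipschitz in [u], while the right-hand side expands
    distances in [v] by [flow_box_expand]. *)
Lemma flow_transition_lipschitz (R : realType) n (X : topologicalType)
    (A : set (chart R n.+1 X)) (phi : R -> X -> X)
    (U : set 'rV[R]_n) (f : 'rV[R]_n -> X) (t0 : R) (u0 v0 : 'rV[R]_n) :
  Ck_atlas 2 A -> Ck_flow 2 A phi -> Ck_into A 1 U f -> nbhs u0 U -> nbhs v0 U ->
  (forall c, A c -> chart_dom c (f v0) ->
     forall w, exists (a : R) v,
     w = a *: generator phi c (f v0) + 'd (chart_map c \o f) v0 v) ->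
  phi t0 (f u0) = f v0 ->
  exists C del : R, [/\ 0 <= C, 0 < del & forall (t t' : R) (u u' v v' : 'rV[R]_n),
    `|t - t0| < del -> `|t' - t0| < del -> `|u - u0| < del -> `|u' - u0| < del ->
    `|v - v0| < del -> `|v' - v0| < del ->
    phi t (f u) = f v -> phi t' (f u') = f v' -> `|v - v'| <= C * `|u - u'|].
Proof.
move=> [atl _] flow fC uU vU span uv; have [[f0 fD] _ _] := flow.
have [c Ac cv] := atl (f v0); have [c0 Ac0 cu] := atl (f u0).
have [C1 [d1 [C10 d10 P1]]] := flow_box_expand flow Ac fC vU cv (span c Ac cv).
have cu1 : chart_dom c (phi t0 (f u0)) by rewrite uv.
have [sd [k kP]] := flow_disc_strict_diff flow Ac0 Ac fC uU cu cu1.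
have [d2 d20 P2] := strict_diff_lipschitz sd kP.
exists (C1 * `|k + 1|), (Num.min d1 d2); split.
- by rewrite mulr_ge0.
- by rewrite lt_min d10.
move=> t t' u u' v v'; rewrite !lt_min.
move=> /andP[t1 _] /andP[t1' _] /andP[_ u2] /andP[_ u2'] /andP[v1 _] /andP[v1' _] e e'.
have back (r : R) x y : phi r (f x) = f y -> phi (t0 - r) (f y) = phi t0 (f x).
  by move=> <-; rewrite -fD subrK.
have := P1 (t0 - t) (t0 - t') v v'.
rewrite ![`|t0 - _|]distrC => /(_ t1 t1' v1 v1') /le_trans; apply.
rewrite (back _ _ _ e) (back _ _ _ e') -mulrA ler_wpM2l //.
have nP (y : 'rV[R]_n) : `|y - u0| < d2 -> `|(t0, y) - (t0, u0) : R * 'rV[R]_n| < d2.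
  by move=> yd; rewrite prod_normE /= subrr normr0 gt_max d20.
apply: (le_trans (P2 (t0, u) (t0, u') (nP _ u2) (nP _ u2'))).
rewrite prod_normE /= subrr normr0.
rewrite (_ : Num.max 0 `|u - u'| = `|u - u'|); last by apply/max_idPr.
by rewrite ler_wpM2r // ler_norm.
Qed.

(** * Reparametrized transverse discs *)

Definition C1_map (R : realType) (V W : normedModType R) (g : V -> W) : Prop :=
  (forall x, differentiable g x) /\ (forall v, continuous (fun x => 'D_v g x)).

Lemma C1_map_continuous (R : realType) (V W : normedModType R) (g : V -> W) :
  C1_map g -> continuous g.
Proof. by move=> [dg _] x; exact: differentiable_continuous. Qed.

Lemma C1_map_cst (R : realType) (V W : normedModType R) (w : W) :
  C1_map (fun _ : V => w).
Proof.
split=> [x|v]; first exact: differentiable_cst.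
have -> : (fun x => 'D_v (fun _ : V => w) x) = cst 0.
  by apply/funext => x; rewrite derive_cst.
exact: cst_continuous.
Qed.

Lemma C1_map_add (R : realType) (V W : normedModType R) (f g : V -> W) :
  C1_map f -> C1_map g -> C1_map (fun x => f x + g x).
Proof.
move=> [df cf] [dg cg]; split=> [x|v]; first exact: differentiableD.
have -> : (fun x => 'D_v (fun x => f x + g x) x) = (fun x => 'D_v f x + 'D_v g x).
  by apply/funext => x; rewrite deriveD //; exact: diff_derivable.
by move=> x; apply: cvgD; [exact: cf | exact: cg].
Qed.

Lemma C1_map_sum (R : realType) (V W : normedModType R) (I : Type) (r : seq I)
    (F : I -> V -> W) :
  (forall i, C1_map (F i)) -> C1_map (fun x => \sum_(i <- r) F i x).
Proof.
move=> CF; elim: r => [|i r IH].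
  under eq_fun do rewrite big_nil; exact: C1_map_cst.
under eq_fun do rewrite big_cons; exact: C1_map_add.
Qed.

Lemma C1_map_mul (R : realType) (V : normedModType R) (f g : V -> R) :
  C1_map f -> C1_map g -> C1_map (fun x => f x * g x).
Proof.
move=> Cf Cg; have [df cf] := Cf; have [dg cg] := Cg.
split=> [x|v]; first exact: differentiableM.
have -> : (fun x => 'D_v (fun x => f x * g x) x) =
          (fun x => f x * 'D_v g x + g x * 'D_v f x).
  by apply/funext => x; rewrite deriveM //; exact: diff_derivable.
move=> x; apply: cvgD; apply: cvgM.
- exact: C1_map_continuous.
- exact: cg.
- exact: C1_map_continuous.
- exact: cf.
Qed.

Lemma C1_map_exp (R : realType) (V : normedModType R) (f : V -> R) j :
  C1_map f -> C1_map (fun x => f x ^+ j).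
Proof.
move=> Cf; elim: j => [|j IH]; first exact: C1_map_cst.
under eq_fun do rewrite exprS; exact: C1_map_mul.
Qed.

Lemma C1_map_scale (R : realType) (V W : normedModType R) (f : V -> R) (w : W) :
  C1_map f -> C1_map (fun x => f x *: w).
Proof.
move=> [df cf]; split=> [x|v]; first exact: differentiableZl.
have -> : (fun x => 'D_v (fun x => f x *: w) x) = (fun x => 'D_v f x *: w).
  apply/funext => x; rewrite !deriveE ?diffZl //; exact: differentiableZl.
move=> x; apply: (@continuous_comp _ _ _ (fun x => 'D_v f x) ( *:%R ^~ w)); first exact: cf.
exact: scalel_continuous.
Qed.

Lemma C1_map_coord (R : realType) n (i : 'I_n) : C1_map (fun u : 'rV[R]_n => u 0 i).
Proof.
split=> [x|v]; first exact: differentiable_coord.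
have -> : (fun x => 'D_v (fun u : 'rV[R]_n => u 0 i) x) = cst (v 0 i).
  apply/funext => x.
  have /derive_mx : derivable (@id 'rV[R]_n) x v by exact: derivable_id.
  by rewrite derive_id => /(congr1 (fun M : 'rV[R]_n => M 0 i)); rewrite mxE.
exact: cst_continuous.
Qed.

Lemma C1_map_radial (R : realType) K m n (a : 'M[R]_(K, m)) :
  C1_map (@radial_map R K m n a).
Proof.
have Cq : C1_map (fun u : 'rV[R]_n => 1 + ridge_poly a u).
  apply: C1_map_add; first exact: C1_map_cst.
  apply: C1_map_sum => k; apply: C1_map_sum => j.
  apply: C1_map_mul; first exact: C1_map_cst.
  apply: C1_map_exp; apply: C1_map_sum => i.
  by apply: C1_map_mul; [exact: C1_map_cst | exact: C1_map_coord].
have -> : @radial_map R K m n a = (fun u => \sum_(i < n)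
    ((1 + ridge_poly a u) * u 0 i) *: delta_mx 0 i).
  apply/funext => u; rewrite /radial_map {2}(row_sum_delta u) scaler_sumr.
  by apply: eq_bigr => i _; rewrite scalerA.
apply: C1_map_sum => i; apply: C1_map_scale; apply: C1_map_mul => //.
exact: C1_map_coord.
Qed.

(** A kernel vector would contradict the expansion of [radial_map_expand] at
    small scales. *)
Lemma diff_radial_inj (R : realType) K m n (a : 'M[R]_(K, m)) (u v : 'rV[R]_n) :
  small_param n a -> `|u| < 2 -> 'd (radial_map a) u v = 0 -> v = 0.
Proof.
move=> sa u2 dv0; have [dh ch] := C1_map_radial n a.
have CK : Ck 1 setT (@radial_map R K m n a).
  by split=> [x _|w x _]; [exact: dh | exact: ch].
have nT : nbhs u (@setT 'rV[R]_n) by exact: filterT.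
have sd := C1_strict_diff (@finite_frame_rV R n) nT CK.
have e0 : 0 < 1 / 4 :> R by lra.
have [del del0 dP] := sd _ e0.
pose t := Num.min del (2 - `|u|) / (2 * (`|v| + 1)).
have M0 : 0 < Num.min del (2 - `|u|) by rewrite lt_min del0 /=; lra.
have v1 : 0 < `|v| + 1 by rewrite ltr_wpDl.
have t0 : 0 < t by rewrite divr_gt0 ?mulr_gt0.
have tv : t * `|v| < Num.min del (2 - `|u|).
  rewrite /t -mulrA gtr_pMr // mulrC ltr_pdivrMr ?mulr_gt0 //; lra.
move: tv; rewrite lt_min => /andP[td tu].
have tvn : `|t *: v| = t * `|v| by rewrite normrZ gtr0_norm.
have uv2 : `|u + t *: v| <= 2.
  by apply: (le_trans (ler_normD _ _)); rewrite tvn; lra.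
have h1 := radial_map_expand sa uv2 (ltW u2).
have := dP (u + t *: v) u; rewrite subrr normr0 addrAC subrr add0r tvn.
move=> /(_ td del0).
have -> : 'd (radial_map a) u (t *: v) = 0 by rewrite linearZ dv0 /= scaler0.
rewrite subr0 => h2.
rewrite addrAC subrr add0r tvn in h1.
have tv0 : t * `|v| = 0 by have := mulr_ge0 (ltW t0) (normr_ge0 v); lra.
by apply/eqP; move/eqP: tv0; rewrite mulf_eq0 (gt_eqF t0) /= normr_eq0.
Qed.

Lemma injective_linear_surjective (R : realType) n
    (L : {linear 'rV[R]_n -> 'rV[R]_n}) :
  (forall v, L v = 0 -> v = 0) -> forall w, exists v, L v = w.
Proof.
move=> Linj w.
have Lu : lin1_mx L \in unitmx.
  rewrite -row_free_unit -kermx_eq0; apply/eqP/row_matrixP => i.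
  rewrite row0; apply: Linj; rewrite -(mul_rV_lin1 L).
  by apply/sub_kermxP; exact: row_sub.
by exists (w *m invmx (lin1_mx L)); rewrite -(mul_rV_lin1 L) mulmxKV.
Qed.

(** In a chart, the directional derivative of the composite is a combination of
    the finitely many derivatives of [chart_map c \o f] along the coordinate
    directions, with the coordinates of the derivative of [g] as coefficients. *)
Lemma Ck_into_comp (R : realType) d n m (X : topologicalType)
    (A : set (chart R d X)) (U : set 'rV[R]_m) (V : set 'rV[R]_n)
    (f : 'rV[R]_m -> X) (g : 'rV[R]_n -> 'rV[R]_m) :
  Ck_into A 1 U f -> open V -> C1_map g -> (forall u, V u -> U (g u)) ->
  Ck_into A 1 V (f \o g).
Proof.
move=> [fc fD] oV Cg VU; have [dg cg] := Cg.
have gc := C1_map_continuous Cg.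
have fgc u : V u -> {for u, continuous (f \o g)}.
  by move=> Vu; apply: continuous_comp; [exact: gc | exact/fc/VU].
split=> // c Ac; have [dF cF] := fD c Ac.
set W := V `&` _; pose F := chart_map c \o f.
have dFg u : W u -> differentiable F (g u).
  by move=> [Vu cu]; apply: dF; split=> //; exact: VU.
have dFG u : W u -> differentiable (F \o g) u.
  by move=> Wu; apply: differentiable_comp; [exact: dg | exact: dFg].
split=> // v u Wu.
have nW : nbhs u W.
  apply: filterI; first by apply: open_nbhs_nbhs; split=> //; exact: Wu.1.
  apply: (fgc u Wu.1).
  by apply: open_nbhs_nbhs; split; [exact: chart_dom_open | exact: Wu.2].
have DE x : W x -> 'D_v (F \o g) x =
    \sum_(i < m) ('D_v g x) 0 i *: 'D_(delta_mx 0 i) F (g x).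
  move=> Wx; have dx := dFg x Wx.
  rewrite deriveE; last exact: dFG.
  rewrite diff_comp //= -(deriveE v (dg x)).
  transitivity ('d F (g x) (\sum_(i < m) ('D_v g x) 0 i *: delta_mx 0 i)).
    by rewrite -row_sum_delta.
  rewrite linear_sum.
  by apply: eq_bigr => i _; rewrite linearZ (deriveE _ dx).
change ('D_v (F \o g) x @[x --> u] --> 'D_v (F \o g) u).
rewrite DE //.
have DEn : \forall x \near u, \sum_(i < m) ('D_v g x) 0 i *: 'D_(delta_mx 0 i) F (g x) =
    'D_v (F \o g) x by apply: filterS nW => x Wx; rewrite DE.
apply: cvg_trans (near_eq_cvg DEn) _.
apply: cvg_big => [|i _]; first exact: add_continuous.
apply: cvgZ.
  apply: (@continuous_comp _ _ _ (fun x => 'D_v g x) (fun w : 'rV[R]_m => w 0 i)).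
    exact: cg.
  exact: coord_continuous.
apply: (@continuous_comp _ _ _ g (fun x => 'D_(delta_mx 0 i) F x)); first exact: gc.
apply: cF; split; [exact/VU/Wu.1 | exact: Wu.2].
Qed.

Definition perturbed_ball (R : realType) K m n (x0 : 'rV[R]_n) (r : R)
    (a : 'M[R]_(K, m)) (u : 'rV[R]_n) : 'rV[R]_n := x0 + r *: radial_map a u.

Lemma C1_map_perturbed_ball (R : realType) K m n (x0 : 'rV[R]_n) (r : R)
    (a : 'M[R]_(K, m)) :
  C1_map (perturbed_ball x0 r a).
Proof.
have [dh ch] := C1_map_radial n a.
apply: C1_map_add; first exact: C1_map_cst.
split=> [x|v]; first exact: differentiableZ.
have -> : (fun x => 'D_v (fun u => r *: radial_map a u) x) =
          (fun x => r *: 'D_v (radial_map a) x).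
  by apply/funext => x; rewrite deriveZ //; exact: diff_derivable.
by move=> x; exact: (cvgZ (cvg_cst r) (ch v x)).
Qed.

Lemma diff_perturbed_ball (R : realType) K m n (x0 : 'rV[R]_n) (r : R)
    (a : 'M[R]_(K, m)) u v :
  'd (perturbed_ball x0 r a) u v = r *: 'd (radial_map a) u v.
Proof.
have [dh ch] := C1_map_radial n a.
have E1 := deriveE v ((C1_map_perturbed_ball x0 r a).1 u).
have E2 := deriveE v (dh u).
apply: (etrans (esym E1)); apply: etrans (congr1 (fun z => r *: z) E2).
have d1 : derivable (fun _ : 'rV[R]_n => x0) u v by exact: derivable_cst.
have d2 : derivable (radial_map a) u v by exact: diff_derivable.
have d3 : derivable (r \*: radial_map a) u v by exact: derivableZ.
by have := deriveD d1 d3; rewrite derive_cst add0r deriveZ.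
Qed.

(** The differential of [g] is an isomorphism at each point of the ball, so the
    tangent spaces of the new disc are those of the old one. *)
Lemma transverse_disc_comp (R : realType) n (X : topologicalType)
    (A : set (chart R n.+1 X)) (phi : R -> X -> X) (U V : set 'rV[R]_n)
    (f : 'rV[R]_n -> X) (g : 'rV[R]_n -> 'rV[R]_n) :
  Ck_into A 1 U f ->
  (forall u v, euclidean_ball u -> euclidean_ball v -> f u = f v -> u = v) ->
  (forall c u, A c -> euclidean_ball u -> chart_dom c (f u) ->
    (forall v, 'd (chart_map c \o f) u v = 0 -> v = 0) /\
    (forall w, exists (a : R) v,
       w = a *: generator phi c (f u) + 'd (chart_map c \o f) u v)) ->
  open V -> @euclidean_ball R n `<=` V -> (forall u, V u -> U (g u)) -> C1_map g ->
  (forall u, euclidean_ball u -> euclidean_ball (g u)) ->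
  (forall u v, euclidean_ball u -> euclidean_ball v -> g u = g v -> u = v) ->
  (forall u v, euclidean_ball u -> 'd g u v = 0 -> v = 0) ->
  transverse_C1_disc A phi [set f (g u) | u in @euclidean_ball R n].
Proof.
move=> fC finj ftr oV BV VU Cg gB ginj dginj.
exists V, (f \o g); split=> //=.
- exact: (Ck_into_comp fC oV Cg VU).
- by move=> u v Bu Bv /= /finj e; apply: ginj => //; apply: e; exact: gB.
move=> c u Ac Bu cu; have [tinj tspan] := ftr c (g u) Ac (gB u Bu) cu.
have dF : differentiable (chart_map c \o f) (g u).
  have [+ _] := fC.2 c Ac; apply; split=> //; exact/VU/BV.
have dE v : 'd (chart_map c \o (f \o g)) u v = 'd (chart_map c \o f) (g u) ('d g u v).
  exact: (congr1 (fun L => L v) (diff_comp (Cg.1 u) dF)).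
split=> [v|w]; first by rewrite dE => /tinj /dginj; exact.
have [b [v ->]] := tspan w.
have [v' <-] := injective_linear_surjective (fun v' => dginj u v' Bu) v.
exists b, v'.
exact: (congr1 (fun z => b *: generator phi c (f (g u)) + z) (esym (dE v'))).
Qed.

(** * Local product structure and flow interior *)

Lemma euclidean_ball_compact (R : realType) n : compact (@euclidean_ball R n).
Proof.
have cube : compact [set v : 'rV[R]_n | forall i, `[(-1 : R), 1]%classic (v ord0 i)].
  exact: (@rV_compact R n (fun=> `[(-1 : R), 1]%classic) (fun=> @segment_compact R _ _)).
have -> : @euclidean_ball R n =
    [set v : 'rV[R]_n | forall i, `[(-1 : R), 1]%classic (v ord0 i)] `&`
    (@norm_sq R n @^-1` [set x | x <= 1]).
  apply/seteqP; split=> [u u1|u []] //; split=> // i /=.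
  have := mx_entry_le u 0 i; have := norm_sq_le1 u1.
  by rewrite in_itv /= -ler_norml => ? /le_trans; exact.
apply: compact_closedI => //.
by apply: closed_comp => [x _|]; [exact: norm_sq_continuous | exact: closed_le].
Qed.

(** The flow tube is the injective image of the compact set
    [[-eta, eta] x ball], so the image of the complement of a neighbourhood of
    [(0, w0)] is compact and avoids [f w0]. *)
Lemma cross_section_local (R : realType) n (X : topologicalType)
    (phi : R -> X -> X) (f : 'rV[R]_n -> X) (eta : R) (w0 : 'rV[R]_n)
    (O : set (R * 'rV[R]_n)) :
  hausdorff_space X -> is_flow phi -> continuous (fun p : R * X => phi p.1 p.2) ->
  (forall u, euclidean_ball u -> {for u, continuous f}) ->
  (forall u v, euclidean_ball u -> euclidean_ball v -> f u = f v -> u = v) ->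
  cross_section phi eta [set f u | u in @euclidean_ball R n] ->
  euclidean_ball w0 ->
  (flow_tube phi eta [set f u | u in @euclidean_ball R n])° (f w0) ->
  nbhs (0, w0) O ->
  \forall y \near f w0, exists s w,
    [/\ `[- eta, eta]%classic s, euclidean_ball w, O (s, w) & phi s (f w) = y].
Proof.
move=> hX [f0 _] phic fc finj [eta0 cs] Bw0 int0 nO.
pose F (p : R * 'rV[R]_n) := phi p.1 (f p.2).
pose K := (`[- eta, eta]%classic `*` @euclidean_ball R n) `&` ~` O°.
have Kc : compact K.
  apply: compact_closedI.
    by apply: compact_setX; [exact: segment_compact | exact: euclidean_ball_compact].
  exact/open_closedC/open_interior.
have FKc : closed (F @` K).
  apply: compact_closed => //; apply: continuous_compact => //.
  apply: continuous_in_subspaceT => -[s w]; rewrite inE => -[[_ /= Bw] _].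
  move=> B /(phic (s, f w)) [[P Q] /= [sP fQ] PQ].
  exists (P, f @^-1` Q) => /=; first by split=> //; exact: (fc w Bw).
  by move=> [x y] [/= Px Qy]; exact: (PQ (x, f y)).
have : nbhs (f w0) (~` (F @` K)).
  apply: open_nbhs_nbhs; split; first exact: closed_openC.
  move=> [[s w] [[/= sI Bw] nOsw]]; rewrite /F /= => e.
  have e0 : 0 \in `[- eta, eta] by rewrite in_itv /=; apply/andP; split; lra.
  have [] := cs (f w) (f w0) s 0; rewrite ?f0 //; [by exists w| by exists w0 |].
  move=> /finj fe s0; apply: nOsw; rewrite s0 (fe Bw Bw0) //.
move=> /filterI /(_ int0); apply: filterS => y [nFK].
move=> /= [s sI [_ [w Bw <-] swy]]; exists s, w; split=> //.
apply: contrapT => nOsw; apply: nFK; exists (s, w) => //; split=> //.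
by move=> /interior_subset.
Qed.

Definition disc (R : realType) n (X : Type) (f : 'rV[R]_n -> X) : set X :=
  [set f u | u in @euclidean_ball R n].

Record disc_section (R : realType) n (X : topologicalType)
    (A : set (chart R n.+1 X)) (phi : R -> X -> X) (eta : R)
    (U : set 'rV[R]_n) (f : 'rV[R]_n -> X) : Prop := DiscSection {
  ds_hausdorff : hausdorff_space X ;
  ds_atlas : Ck_atlas 2 A ;
  ds_flow : Ck_flow 2 A phi ;
  ds_open : open U ;
  ds_ball : @euclidean_ball R n `<=` U ;
  ds_C1 : Ck_into A 1 U f ;
  ds_inj : forall u v, euclidean_ball u -> euclidean_ball v -> f u = f v -> u = v ;
  ds_trans : forall c u, A c -> euclidean_ball u -> chart_dom c (f u) ->
    (forall v, 'd (chart_map c \o f) u v = 0 -> v = 0) /\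
    (forall w, exists (a : R) v,
       w = a *: generator phi c (f u) + 'd (chart_map c \o f) u v) ;
  ds_cross : cross_section phi eta (disc f) }.

Lemma disc_section_cts (R : realType) n (X : topologicalType)
    (A : set (chart R n.+1 X)) (phi : R -> X -> X) (eta : R)
    (U : set 'rV[R]_n) (f : 'rV[R]_n -> X) u :
  disc_section A phi eta U f -> euclidean_ball u -> {for u, continuous f}.
Proof. by move=> ds Bu; apply: (ds_C1 ds).1; exact: (ds_ball ds). Qed.

Lemma disc_section_nbhs (R : realType) n (X : topologicalType)
    (A : set (chart R n.+1 X)) (phi : R -> X -> X) (eta : R)
    (U : set 'rV[R]_n) (f : 'rV[R]_n -> X) u :
  disc_section A phi eta U f -> euclidean_ball u -> nbhs u U.
Proof.
move=> ds Bu; apply: open_nbhs_nbhs; split; first exact: (ds_open ds).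
exact: (ds_ball ds).
Qed.

Lemma disc_section_local (R : realType) n (X : topologicalType)
    (A : set (chart R n.+1 X)) (phi : R -> X -> X) (eta : R)
    (U : set 'rV[R]_n) (f : 'rV[R]_n -> X) w0 (O : set (R * 'rV[R]_n)) :
  disc_section A phi eta U f -> euclidean_ball w0 ->
  (flow_tube phi eta (disc f))° (f w0) -> nbhs (0, w0) O ->
  \forall y \near f w0, exists s w,
    [/\ `[- eta, eta]%classic s, euclidean_ball w, O (s, w) & phi s (f w) = y].
Proof.
move=> ds Bw int0 nO; have [fl phic _] := ds_flow ds.
apply: cross_section_local => //; first exact: (ds_hausdorff ds).
- by move=> u Bu; exact: disc_section_cts ds Bu.
- exact: (ds_inj ds).
- exact: (ds_cross ds).
Qed.

(** If [u0] were on the boundary sphere, the points [f ((1 + s) u0)] with small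
    [s > 0] would be in the tube, so they would equal some [phi_t (f w)] with
    [w] in the ball and [(t, w)] near [(0, u0)]; but [flow_box_expand] says that
    then [w = (1 + s) u0], which is outside the ball. *)
Lemma flow_interior_in_open_disc (R : realType) n (X : topologicalType)
    (A : set (chart R n.+1 X)) (phi : R -> X -> X) (eta : R)
    (U : set 'rV[R]_n) (f : 'rV[R]_n -> X) u0 :
  disc_section A phi eta U f -> euclidean_ball u0 ->
  (flow_tube phi eta (disc f))° (f u0) -> norm_sq u0 < 1.
Proof.
move=> ds Bu0 int0; rewrite lt_neqAle; apply/andP; split; last exact: Bu0.
apply/eqP => u01; have [[f0 _] _ _] := ds_flow ds.
have [c Ac cu] := (ds_atlas ds).1 (f u0).
have nU := disc_section_nbhs ds Bu0.
have [C [del [C0 del0 exd]]] := flow_box_expand (ds_flow ds) Ac (ds_C1 ds) nU cu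
  (ds_trans ds Ac Bu0 cu).2.
have loc := disc_section_local ds Bu0 int0 (nbhsx_ballx (0, u0) del del0).
have := disc_section_cts ds Bu0 loc.
rewrite nbhs_simpl /= => /nbhs_ballP[r /= r0 rP].
have u0n : `|u0| <= 1 by apply: norm_sq_le1; rewrite u01.
(* small enough for [(1 + s) u0] to be in both neighbourhoods *)
pose s := Num.min r del / 2.
have m0 : 0 < Num.min r del by rewrite lt_min r0.
have s0 : 0 < s by rewrite divr_gt0.
have sm : s < Num.min r del by rewrite /s; lra.
have su : `|s *: u0| < Num.min r del.
  apply: le_lt_trans sm; rewrite normrZ gtr0_norm // ler_piMr // ltW //.
move: su; rewrite lt_min => /andP[sr sd].
have [|t [w [_ Bw [/= td wd] e]]] := rP (u0 + s *: u0).
  by rewrite mx_norm_ball /ball_ /= opprD addrA subrr add0r normrN.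
have := exd t 0 w (u0 + s *: u0).
rewrite normr0 addrAC subrr add0r f0 e subrr normr0 mulr0 => h.
have wu : `|w - (u0 + s *: u0)| <= 0.
  apply: h => //; last by rewrite mx_norm_ball /ball_ /= distrC in wd.
  by move: td; rewrite /ball /= sub0r normrN.
have {wu} wE : w = u0 + s *: u0.
  by apply/eqP; rewrite -subr_eq0 -normr_eq0 eq_le wu normr_ge0.
have : norm_sq w = (1 + s) ^+ 2.
  transitivity ((1 + s) ^+ 2 * norm_sq u0); last by rewrite u01 mulr1.
  rewrite wE /norm_sq mulr_sumr; apply: eq_bigr => i _.
  by rewrite !mxE; ring.
move: Bw; rewrite /euclidean_ball /= -/(norm_sq w) => w1 w2.
by rewrite w2 in w1; nra.
Qed.

Lemma perturbed_ball_near (R : realType) K m n (x0 : 'rV[R]_n) (r : R)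
    (a : 'M[R]_(K, m)) (u0 : 'rV[R]_n) :
  0 < r -> small_param n a -> norm_sq u0 < 1 ->
  \forall w \near perturbed_ball x0 r a u0,
    exists2 u, norm_sq u <= 1 & perturbed_ball x0 r a u = w.
Proof.
move=> r0 sa u01; have := radial_map_open sa u01.
have back : radial_map a u0 = r^-1 *: (perturbed_ball x0 r a u0 - x0).
  by rewrite /perturbed_ball addrAC subrr add0r scalerA mulVf ?scale1r // gt_eqF.
rewrite back => near_h.
have ct : {for perturbed_ball x0 r a u0, continuous (fun w : 'rV[R]_n => r^-1 *: (w - x0))}.
  exact: (cvgZ (cvg_cst r^-1) (cvgB cvg_id (cvg_cst x0))).
have := ct _ near_h; rewrite nbhs_simpl /=; apply: filterS => w /= [u u1 uE].
exists u => //; rewrite /perturbed_ball uE scalerA divff ?gt_eqF // scale1r.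
by rewrite addrC subrK.
Qed.

(** Points near the given one are carried by short pieces of orbits to points
    [f w] with [w] near [perturbed_ball x0 r a u], and these [w] are in the
    perturbed ball.  So the flow boundary of the perturbed disc is contained in
    the image of the unit sphere. *)
Lemma perturbed_flow_interior (R : realType) K m n (X : topologicalType)
    (A : set (chart R n.+1 X)) (phi : R -> X -> X) (eta : R)
    (U : set 'rV[R]_n) (f : 'rV[R]_n -> X) (x0 : 'rV[R]_n) (r : R)
    (a : 'M[R]_(K, m)) :
  disc_section A phi eta U f -> 0 < r -> small_param n a ->
  (forall u, euclidean_ball u -> euclidean_ball (perturbed_ball x0 r a u) /\
     (flow_tube phi eta (disc f))° (f (perturbed_ball x0 r a u))) ->
  forall u, norm_sq u < 1 ->
  flow_interior phi eta (disc (f \o perturbed_ball x0 r a)) (f (perturbed_ball x0 r a u)).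
Proof.
move=> ds r0 sa inner u u1; have Bu : euclidean_ball u by exact: ltW.
have [Bg int0] := inner u Bu.
split; last by exists u.
have nO : nbhs (0 : R, perturbed_ball x0 r a u) [set p |
    exists2 u, norm_sq u <= 1 & perturbed_ball x0 r a u = p.2].
  exact: cvg_snd (perturbed_ball_near x0 r0 sa u1).
have := disc_section_local ds Bg int0 nO.
apply: filterS => y [s [w [sI _ [v v1 /= vw] <-]]].
by exists s => //; exists (f w) => //; exists v; rewrite //= vw.
Qed.

(** * Periodic points and recurrence *)

Definition periodic_point (R : realType) (X : Type) (phi : R -> X -> X) : set X :=
  [set x | exists2 T, 0 < T & phi T x = x].

(** This separates the periods of a point of the section, and the hits of the
    section by an orbit, by more than [eta]. *)
Lemma cross_section_no_short_return (R : realType) (X : Type) (phi : R -> X -> X)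
    (eta : R) (S : set X) x y s :
  is_flow phi -> cross_section phi eta S -> S x -> S y ->
  phi s x = y -> `|s| <= eta -> x = y /\ s = 0.
Proof.
move=> [f0 _] [eta0 cs] Sx Sy sxy; rewrite ler_norml => seta.
apply: (cs x y s 0) => //; rewrite ?f0 //= in_itv //=.
by apply/andP; split; lra.
Qed.

(** A period [T1] within [eta] of the infimum of all periods is the least one: a
    smaller period [s] would give the period [T1 - s < eta]. *)
Lemma periodic_least_period (R : realType) (X : Type) (phi : R -> X -> X)
    (eta : R) (S : set X) x :
  is_flow phi -> cross_section phi eta S -> S x -> periodic_point phi x ->
  exists T, least_period phi x T.
Proof.
move=> fl cs Sx [T T0 Tx]; have eta0 := cs.1; have [f0 fD] := fl.
pose E := [set s : R | 0 < s /\ phi s x = x].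
have lbE : lbound E 0 by move=> s [/ltW].
have iE : has_inf E by split; [exists T | exists 0].
have [T1 [T10 T1x] T1inf] := inf_adherent eta0 iE.
exists T1; split=> // s s0 sT1 sx.
have infs : inf E <= s by apply: ge_inf; [exists 0 | split].
have : phi (T1 - s) x = x.
  by rewrite -{1}sx -fD subrK.
move=> /(cross_section_no_short_return fl cs Sx Sx) [].
  by rewrite ger0_norm; lra.
by move=> _; lra.
Qed.

(** Two hits of the section by an orbit whose times are closer than [eta] coincide,
    so the integer part of the time divided by [eta] tells the hits apart. *)
Lemma orbit_section_countable (R : realType) (X : Type) (phi : R -> X -> X)
    (eta : R) (S : set X) x :
  is_flow phi -> cross_section phi eta S -> countable (flow_orbit phi x `&` S).
Proof.
move=> fl cs; have eta0 := cs.1; have [f0 fD] := fl.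
have /choice[t tP] : forall y, exists t, (flow_orbit phi x `&` S) y -> phi t x = y.
  move=> y; have [[t _ <-]|n] := pselect (flow_orbit phi x y); first by exists t.
  by exists 0 => -[].
apply/countable_injP; exists (fun y => pickle (Num.floor (t y / eta))).
move=> y z; rewrite !inE => Oy Oz /(pcan_inj pickleK) e.
have ty := tP y Oy; have tz := tP z Oz.
have yz : phi (t z - t y) y = z.
  have : phi (t z - t y) (phi (t y) x) = z by rewrite -fD subrK.
  by rewrite ty.
have [//|-> //] := cross_section_no_short_return fl cs Oy.2 Oz.2 yz.
have /andP[y1 y2] := floor_itv (t y / eta); have /andP[z1 z2] := floor_itv (t z / eta).
rewrite e in y1 y2.
rewrite ler_pdivlMr // in y1; rewrite ler_pdivlMr // in z1.
rewrite ltr_pdivrMr // in y2; rewrite ltr_pdivrMr // in z2.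
rewrite intrD mulrDl mul1r in y2 z2.
by apply/ler_normlP; split; lra.
Qed.

Lemma periodic_section_countable (R : realType) (X : pointedType) (phi : R -> X -> X)
    (eta : R) (S : set X) :
  is_flow phi -> cross_section phi eta S ->
  (forall t, 0 < t -> finite_set (periodic_orbits_lt phi t)) ->
  countable (S `&` periodic_point phi).
Proof.
move=> fl cs fin; have [f0 fD] := fl.
apply: (@sub_countable _ _ _ (\bigcup_(n : nat)
   \bigcup_(g in periodic_orbits_lt phi n.+1%:R) (g `&` S))).
  apply: subset_card_le => x [Sx px].
  have [T lT] := periodic_least_period fl cs Sx px.
  exists (Num.trunc T) => //; exists (flow_orbit phi x); last first.
    by split=> //; exists 0.
  exists x => //; exists T => //=; exact: truncnS_gt.
apply: bigcup_countable => // n _; apply: bigcup_countable.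
  by apply: finite_set_countable; apply: fin; rewrite ltr0n.
by move=> _ [x _ <-]; exact: (orbit_section_countable x fl cs).
Qed.

Lemma closed_borel (X : ptopologicalType) (B : set X) :
  closed B -> measurable (B : set (borel X)).
Proof.
move=> cB; rewrite -(setCK B); apply: measurableC.
by apply: sub_sigma_algebra; exact: closed_openC.
Qed.

(** Let [C j] be the set of the points that are in [B] at some step [k >= j].
    The preimage of [C j] under one step is [C j.+1], so all [C j] have the same
    measure, which is positive; it is also the measure of their intersection. *)
Lemma invariant_recurrence (R : realType) (X : ptopologicalType)
    (phi : R -> X -> X) (mu : probability (borel X) R) (s : R) (B : set X) :
  is_flow phi -> (forall t, continuous (phi t)) -> invariant_probability phi mu ->
  closed B -> mu B != 0%E ->
  exists y, forall N : nat, exists2 k, (N <= k)%N & B (phi (k%:R * s) y).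
Proof.
move=> [f0 fD] phic inv cB muB.
pose C (j : nat) : set (borel X) :=
  \bigcup_(k in [set k | (j <= k)%N]) (phi (k%:R * s) @^-1` B).
have mC j : measurable (C j).
  apply: bigcup_measurable => k _; apply: closed_borel.
  by apply: closed_comp => // x _; exact: phic.
have CS j : mu (C j.+1) = mu (C j).
  rewrite -(inv s (C j) (mC j)); congr (mu _); apply/seteqP; split=> x.
    move=> [[//|k] /= jk Bk]; exists k => //=.
    by rewrite -fD -{2}(mul1r s) -mulrDl natr1.
  move=> [k /= jk Bk]; exists k.+1 => //=.
  by move: Bk; rewrite -fD -{2}(mul1r s) -mulrDl natr1.
have CE j : mu (C j) = mu (C 0%N) by elim: j => // j <-.
have noninc : nonincreasing_seq C.
  apply/nonincreasing_seqP => j; apply/subsetPset => x [k /= jk Bk].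
  by exists k => //=; exact: ltnW.
have cvC : (mu \o C) x @[x --> \oo] --> mu (\bigcap_j C j).
  apply: nonincreasing_cvg_mu => //; last exact: bigcapT_measurable.
  by rewrite (le_lt_trans (probability_le1 _ _)) // ltry.
have : mu (C 0%N) = mu (\bigcap_j C j).
  have := @cvg_lim _ (@ereal_hausdorff R) _ _ _ _ _ cvC => <-.
  rewrite (_ : mu \o C = cst (mu (C 0%N))) ?lim_cst //.
  by apply/funext => j /=; exact: CE.
move=> CI; have : \bigcap_j C j !=set0.
  apply/set0P/eqP => I0; move: muB; rewrite -measure_le0 => /negP; apply.
  have <- : mu (C 0%N) = 0%E by rewrite CI I0 measure0.
  apply: le_measure; rewrite ?inE //.
    exact: closed_borel.
  by move=> x Bx; exists 0%N => //=; rewrite mul0r f0.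
by move=> [y yC]; exists y => N; have [k /= Nk Bk] := yC N I; exists k.
Qed.

(** * Parameters with a recurrent boundary are thin *)

(** The cells of index [M] cut the line into intervals of length [1 / M.+1]; they
    provide countably many small neighbourhoods that cover everything. *)
Definition cell (R : realType) (M : nat) (x : R) : int := Num.floor (M.+1%:R * x).

Lemma cell_close (R : realType) (M : nat) (x y : R) :
  cell M x = cell M y -> `|x - y| <= M.+1%:R^-1.
Proof.
rewrite /cell => e; set h : R := M.+1%:R in e *; have h0 : 0 < h by rewrite ltr0n.
have /andP[x1 x2] := floor_itv (h * x); have /andP[y1 y2] := floor_itv (h * y).
rewrite e in x1 x2; rewrite intrD in x2 y2.
rewrite -(ler_pM2l h0) mulfV ?gt_eqF // -{1}(gtr0_norm h0) -normrM.
by apply/ler_normlP; split; lra.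
Qed.

Definition vcell (R : realType) n (M : nat) (u : 'rV[R]_n) : {ffun 'I_n -> int} :=
  [ffun j => cell M (u 0 j)].

Lemma vcell_close (R : realType) n (M : nat) (u v : 'rV[R]_n) :
  vcell M u = vcell M v -> `|u - v| <= M.+1%:R^-1.
Proof.
move=> e; apply: mx_norm_le => [|i j]; first by rewrite invr_ge0.
rewrite ord1 !mxE; apply: cell_close.
by have := congr1 (fun c : {ffun 'I_n -> int} => c j) e; rewrite !ffunE.
Qed.

Definition periodic_boundary (R : realType) n K (X : Type) (phi : R -> X -> X)
    (f : 'rV[R]_n -> X) (x0 : 'rV[R]_n) (r rho : R) (code : X -> nat) (N : nat) :
    set 'M[R]_(K, n.+1) :=
  [set a | `|a| < rho /\ exists th,
    [/\ norm_sq th = 1, code (f (perturbed_ball x0 r a th)) = N &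
     periodic_point phi (f (perturbed_ball x0 r a th))]].

(** The parameters whose boundary contains [n.+1] points of an orbit, sorted
    according to countably many data: the cells [ct] and [cu] of the times and of
    the points, a row [k], and a constant [M] which bounds both the Lipschitz
    constants of the transitions of the flow within these cells and the constant
    of [small_poly_coef].  Making [M] part of the data gives uniform estimates on
    each of these sets without any compactness argument. *)
Definition itinerary_params (R : realType) n K (X : Type) (phi : R -> X -> X)
    (f : 'rV[R]_n -> X) (x0 : 'rV[R]_n) (r rho : R) (M : nat) (k : 'I_K)
    (ct : {ffun 'I_n.+1 -> int}) (cu : {ffun 'I_n.+1 -> {ffun 'I_n -> int}}) :
    set 'M[R]_(K, n.+1) :=
  [set a | [/\ `|a| < rho,
    forall i t t' u u' v v', cell M t = ct i -> cell M t' = ct i ->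
      vcell M u = cu 0 -> vcell M u' = cu 0 -> vcell M v = cu i -> vcell M v' = cu i ->
      phi t (f u) = f v -> phi t' (f u') = f v' -> `|v - v'| <= M%:R * `|u - u'| &
    exists (th : 'I_n.+1 -> 'rV[R]_n) (t : 'I_n.+1 -> R),
      [/\ forall i, norm_sq (th i) = 1,
          forall i, phi (t i) (f (perturbed_ball x0 r a (th 0))) =
            f (perturbed_ball x0 r a (th i)),
          forall i, cell M (t i) = ct i,
          forall i, vcell M (perturbed_ball x0 r a (th i)) = cu i &
          forall (b : 'I_n.+1 -> R) (s : R),
            (forall i, `|\sum_(j < n.+1) b j * moment_form k (th i) ^+ j| <= s) ->
            forall j, `|b j| <= M%:R * s]]].

(** The [n] coordinates of the first point and the rows of [a] other than [k]
    determine [a]: the first point determines the other ones through the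
    transitions of the flow, and these determine row [k] by
    [ridge_coef_stable]. *)
Lemma thin_itinerary_params (R : realType) n K (X : Type) (phi : R -> X -> X)
    (f : 'rV[R]_n -> X) (x0 : 'rV[R]_n) (r rho : R) M (k : 'I_K) ct cu :
  0 < r ->
  (forall a : 'M[R]_(K, n.+1), `|a| < rho -> small_param n a) ->
  (forall a : 'M[R]_(K, n.+1), `|a| < rho -> forall u : 'rV[R]_n,
     norm_sq u <= 1 -> norm_sq (perturbed_ball x0 r a u) <= 1) ->
  thin (itinerary_params phi f x0 r rho M k ct cu).
Proof.
move=> r0 small inner; pose g (a : 'M[R]_(K, n.+1)) := perturbed_ball x0 r a.
pose J : finType := ('I_n + {k' : 'I_K | k' != k} * 'I_n.+1)%type.
have cardJ : (#|J| < K * n.+1)%N.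
  rewrite card_sum card_prod !card_ord card_sig.
  have -> : #|[pred k' : 'I_K | k' != k]| = K.-1.
    by rewrite cardC1 card_ord.
  have K0 : (0 < K)%N by apply: leq_ltn_trans (ltn_ord k).
  by rewrite -[X in (_ < X * _)%N](prednK K0) mulSn ltn_add2r.
have /choice[th thP] : forall a, exists th : 'I_n.+1 -> 'rV[R]_n,
    itinerary_params phi f x0 r rho M k ct cu a -> exists t : 'I_n.+1 -> R,
      [/\ forall i, norm_sq (th i) = 1,
          forall i, phi (t i) (f (g a (th 0))) = f (g a (th i)),
          forall i, cell M (t i) = ct i,
          forall i, vcell M (g a (th i)) = cu i &
          forall (b : 'I_n.+1 -> R) (s : R),
            (forall i, `|\sum_(j < n.+1) b j * moment_form k (th i) ^+ j| <= s) ->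
            forall j, `|b j| <= M%:R * s].
  move=> a.
  have [[_ _ [th [t tP]]]|na] := pselect (itinerary_params phi f x0 r rho M k ct cu a).
    by exists th => _; exists t.
  by exists (fun=> 0).
pose e (a : 'M[R]_(K, n.+1)) (j : J) : R := match j with
  | inl j => g a (th a 0) 0 j
  | inr (k', j) => a (val k') j end.
have [D D0 DP] := @ridge_coef_stable R K n.+1 n M%:R.
exists J, e, (D * (1 + M%:R / r)), (1 + `|rho|); split => //.
- move=> a Ba; have [t [th1 _ _ _ _]] := thP a Ba; have [arho _ _] := Ba.
  move=> [j|[k' j]] /=.
    apply: (le_trans (mx_entry_le _ _ _)); apply: (@le_trans _ _ 1); last by rewrite lerDl.
    by apply/norm_sq_le1/inner => //; rewrite th1.
  apply: (le_trans (mx_entry_le _ _ _)); apply: (le_trans (ltW arho)).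
  by apply: (le_trans (ler_norm _)); rewrite lerDr.
move=> a a' t Ba Ba' t0 et.
have [ti [th1 or ct1 cu1 van]] := thP a Ba; have [ti' [th1' or' ct1' cu1' _]] := thP a' Ba'.
have [arho lip _] := Ba; have [arho' _ _] := Ba'.
have g0 : `|g a (th a 0) - g a' (th a' 0)| <= t.
  by apply: mx_norm_le => // i j; rewrite ord1 mxE [X in _ + X]mxE; exact: (et (inl j)).
have gi i : `|g a (th a i) - g a' (th a' i)| <= M%:R * t.
  apply: (@le_trans _ _ (M%:R * `|g a (th a 0) - g a' (th a' 0)|)); last first.
    by rewrite ler_wpM2l.
  by apply: lip (ct1 i) (ct1' i) (cu1 0) (cu1' 0) (cu1 i) (cu1' i) (or i) (or' i).
have Mr0 : 0 <= M%:R / r :> R by rewrite divr_ge0 // ltW.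
rewrite -mulrA; apply: (DP a a' k (th a) (th a')) => //.
- exact: small.
- exact: small.
- move=> i; rewrite mulrDl mul1r; apply: (@le_trans _ _ (M%:R / r * t)); last first.
    by rewrite lerDr.
  rewrite mulrAC ler_pdivlMr // mulrC -{1}(gtr0_norm r0) -normrZ.
  apply: le_trans (gi i); rewrite le_eqVlt; apply/orP; left; apply/eqP.
  by rewrite /g /perturbed_ball; congr `|_|; apply/matrixP => u v; rewrite !mxE; ring.
- move=> k' j kk'; apply: (@le_trans _ _ t).
    exact: (et (inr (exist _ k' kk', j))).
  by rewrite mulrDl mul1r lerDl mulr_ge0.
- by rewrite mulr_ge0 // addr_ge0.
Qed.

(** For a fixed point, [a] satisfies one affine equation, in which the
    coefficient of the entry of index [(0, 0)], that is of the constant term of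
    the ridge polynomial, is 1. *)
Lemma thin_periodic_boundary (R : realType) n K (X : Type) (phi : R -> X -> X)
    (f : 'rV[R]_n -> X) (x0 : 'rV[R]_n) (r rho : R) (S : set X) code N :
  0 < r ->
  (forall a : 'M[R]_(K, n.+1), `|a| < rho -> small_param n a) ->
  (forall a : 'M[R]_(K, n.+1), `|a| < rho -> forall u : 'rV[R]_n,
     norm_sq u <= 1 -> norm_sq (perturbed_ball x0 r a u) <= 1) ->
  (0 < K)%N ->
  (forall u v, norm_sq u <= 1 -> norm_sq v <= 1 -> f u = f v -> u = v) ->
  (forall u, norm_sq u <= 1 -> S (f u)) ->
  {in S `&` periodic_point phi &, injective code} ->
  thin (periodic_boundary (K := K) phi f x0 r rho code N).
Proof.
move=> r0 small inner; pose g (a : 'M[R]_(K, n.+1)) := perturbed_ball x0 r a.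
move=> K0 finj fS codeI; pose kj : 'I_K * 'I_n.+1 := (Ordinal K0, 0).
pose J : finType := {p : 'I_K * 'I_n.+1 | p != kj}.
have cardJ : (#|J| < K * n.+1)%N.
  by rewrite card_sig cardC1 card_prod !card_ord prednK // muln_gt0 K0.
pose e (a : 'M[R]_(K, n.+1)) (j : J) : R := a (val j).1 (val j).2.
have [L L0 LP] := ridge_poly_lipschitz R K n.+1 n.
exists J, e, (1 + L), rho; split => //.
  move=> a [arho _] j; apply: (le_trans (mx_entry_le _ _ _)); exact: ltW.
move=> a a' t [arho [th [th1 ca pa]]] [arho' [th' [th1' ca' pa']]] t0 et.
have Bth (u : 'rV[R]_n) : norm_sq u = 1 -> norm_sq u <= 1 by move=> ->.
have gB := inner _ arho _ (Bth _ th1); have gB' := inner _ arho' _ (Bth _ th1').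
have ff : f (g a th) = f (g a' th').
  apply: codeI; rewrite ?inE //; last by rewrite ca.
    by split=> //; exact: fS.
  by split=> //; exact: fS.
have gg := finj _ _ gB gB' ff.
have rr : radial_map a th = radial_map a' th'.
  move: gg; rewrite /g /perturbed_ball => /addrI /scalerI; apply.
  by rewrite gt_eqF.
have [q0 u0] := radial_map_sphere_lipschitz (small _ arho) (small _ arho') th1 th1'.
rewrite rr subrr normr0 !mulr0 in q0 u0.
have thE : th = th'.
  by apply/eqP; rewrite -subr_eq0 -normr_eq0 eq_le u0 normr_ge0.
have qE : ridge_poly (a - a') th = 0.
  rewrite ridge_polyB -thE in q0 *.
  by apply/eqP; rewrite -normr_eq0 eq_le q0 normr_ge0.
pose b : 'M[R]_(K, n.+1) := \matrix_(i, j) (if (i, j) == kj then 0 else (a - a') i j).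
have bt : `|b| <= t.
  apply: mx_norm_le => // i j; rewrite [b i j]mxE; case: ifPn => [_|ne].
    by rewrite normr0.
  by rewrite !mxE; exact: (et (exist _ (i, j) ne)).
have th2 : `|th| <= 2 by have := norm_sq_le1 (Bth _ th1); lra.
have qb : ridge_poly (a - a') th = (a - a') kj.1 kj.2 + ridge_poly b th.
  have -> : (a - a') kj.1 kj.2 = ridge_poly ((a - a') - b) th.
    rewrite /ridge_poly (bigD1 kj.1) //= (bigD1 kj.2) //= expr0 mulr1.
    rewrite big1 => [|j jk]; last first.
      rewrite ![in X in X * _]mxE /kj xpair_eqE eqxx (negPf jk) /=.
      by rewrite subrr mul0r.
    rewrite big1 => [|i ik]; last first.
      rewrite big1 // => j _; rewrite ![in X in X * _]mxE /kj xpair_eqE (negPf ik) /=.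
      by rewrite subrr mul0r.
    by rewrite !addr0 ![in RHS]mxE eqxx subr0 !mxE.
  by rewrite (ridge_polyB (a - a') b th) subrK.
have [qbL _] := LP b th th th2 th2.
have Lt := ler_wpM2l (ltW L0) bt.
have Lt0 := mulr_ge0 (ltW L0) t0.
apply: mx_norm_le => [|i j]; first by rewrite mulr_ge0 // addr_ge0 // ltW.
rewrite mulrDl mul1r; have [[-> ->]|ne] := eqVneq (i, j) kj.
  have -> : (a - a') (Ordinal K0) 0 = - ridge_poly b th.
    by apply/eqP; rewrite -addr_eq0 -[X in _ == X]qE qb.
  by rewrite normrN; lra.
by rewrite !mxE; have := et (exist _ (i, j) ne); rewrite /e /=; lra.
Qed.

(** * The generic disc *)

(** [M] exceeds all the constants involved, and the cells of index [M] are smaller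
    than the radii of the neighbourhoods where these constants are valid. *)
Lemma itinerary_paramsP (R : realType) n K (X : topologicalType)
    (A : set (chart R n.+1 X)) (phi : R -> X -> X) (eta : R)
    (U : set 'rV[R]_n) (f : 'rV[R]_n -> X) (x0 : 'rV[R]_n) (r rho : R)
    (a : 'M[R]_(K, n.+1)) (th : 'I_n.+1 -> 'rV[R]_n) (t : 'I_n.+1 -> R) :
  disc_section A phi eta U f -> (n.+1 * n.+1 * n.+1 < K)%N -> `|a| < rho ->
  (forall u, norm_sq u <= 1 -> norm_sq (perturbed_ball x0 r a u) <= 1) ->
  injective th -> (forall i, norm_sq (th i) = 1) ->
  (forall i, phi (t i) (f (perturbed_ball x0 r a (th 0))) =
             f (perturbed_ball x0 r a (th i))) ->
  exists M k ct cu, itinerary_params phi f x0 r rho M k ct cu a.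
Proof.
move=> ds nK arho inner thI th1 orb.
have [k kI] := separating_moment_form thI nK.
have [Cv CvP] := small_poly_coef kI.
have Bg i : euclidean_ball (perturbed_ball x0 r a (th i)).
  by apply: inner; rewrite th1.
have /choice[CD CDP] : forall i, exists CD : R * R, 0 <= CD.1 /\ 0 < CD.2 /\
    forall (s s' : R) (u u' v v' : 'rV[R]_n),
    `|s - t i| < CD.2 -> `|s' - t i| < CD.2 ->
    `|u - perturbed_ball x0 r a (th 0)| < CD.2 ->
    `|u' - perturbed_ball x0 r a (th 0)| < CD.2 ->
    `|v - perturbed_ball x0 r a (th i)| < CD.2 ->
    `|v' - perturbed_ball x0 r a (th i)| < CD.2 ->
    phi s (f u) = f v -> phi s' (f u') = f v' -> `|v - v'| <= CD.1 * `|u - u'|.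
  move=> i; have span c Ac cv := (ds_trans ds (c := c) Ac (Bg i) cv).2.
  have [C [D [C0 D0 CDi]]] := flow_transition_lipschitz (ds_atlas ds) (ds_flow ds)
    (ds_C1 ds) (disc_section_nbhs ds (Bg 0)) (disc_section_nbhs ds (Bg i)) span (orb i).
  by exists (C, D).
pose M := Num.trunc (\sum_i ((CD i).1 + (CD i).2^-1) + `|Cv|).
have Mlt := truncnS_gt (\sum_i ((CD i).1 + (CD i).2^-1) + `|Cv|).
have sumi i : (CD i).1 + (CD i).2^-1 <= \sum_i ((CD i).1 + (CD i).2^-1).
  rewrite [leRHS](bigD1 i) //= lerDl; apply: sumr_ge0 => l _.
  by have [? [? _]] := CDP l; rewrite addr_ge0 // invr_ge0 ltW.
exists M.+1, k, [ffun i => cell M.+1 (t i)],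
  [ffun i => vcell M.+1 (perturbed_ball x0 r a (th i))]; split=> //.
- move=> i s s' u u' v v'; rewrite !ffunE.
  have [C0 [D0 LP]] := CDP i; have := sumi i; rewrite -/M in Mlt => si.
  have D1 : 0 <= (CD i).2^-1 by rewrite invr_ge0 ltW.
  have MD : M.+2%:R^-1 < (CD i).2 :> R.
    rewrite -[ltRHS]invrK ltf_pV2 ?posrE ?invr_gt0 // ?ltr0n //.
    by rewrite -[M.+2%:R]natr1; have := normr_ge0 Cv; lra.
  move=> /cell_close s1 /cell_close s1' /vcell_close u1 /vcell_close u1'.
  move=> /vcell_close v1 /vcell_close v1' e e'.
  have lt (z : R) : z <= M.+2%:R^-1 -> z < (CD i).2 by move=> /le_lt_trans; apply.
  apply: (le_trans (LP s s' u u' v v' (lt _ s1) (lt _ s1') (lt _ u1) (lt _ u1')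
    (lt _ v1) (lt _ v1') e e')).
  by rewrite ler_wpM2r //; have := normr_ge0 Cv; lra.
- exists th, t; split=> // [i|i|b s bs j]; rewrite ?ffunE //.
  have s0 : 0 <= s by apply: le_trans (bs 0).
  apply: (le_trans (CvP b s bs j)); rewrite ler_wpM2r //.
  have := ler_norm Cv; rewrite -/M in Mlt.
  have : 0 <= \sum_i ((CD i).1 + (CD i).2^-1).
    apply: sumr_ge0 => l _.
    by have [? [? _]] := CDP l; rewrite addr_ge0 // invr_ge0 ltW.
  lra.
Qed.

Lemma thin_set0 (R : realType) p q : (0 < p * q)%N -> thin (set0 : set 'M[R]_(p, q)).
Proof.
by move=> pq; exists void, (fun _ _ => 0), 0, 0; split=> //; rewrite card_void.
Qed.

Lemma generic_param (R : realType) n K (X : topologicalType)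
    (A : set (chart R n.+1 X)) (phi : R -> X -> X) (eta : R)
    (U : set 'rV[R]_n) (f : 'rV[R]_n -> X) (x0 : 'rV[R]_n) (r rho : R) :
  disc_section A phi eta U f -> countable (disc f `&` periodic_point phi) ->
  (n.+1 * n.+1 * n.+1 < K)%N -> 0 < r -> 0 < rho ->
  (forall a : 'M[R]_(K, n.+1), `|a| < rho -> small_param n a) ->
  (forall a : 'M[R]_(K, n.+1), `|a| < rho -> forall u : 'rV[R]_n,
     norm_sq u <= 1 -> norm_sq (perturbed_ball x0 r a u) <= 1) ->
  exists2 a : 'M[R]_(K, n.+1), `|a| < rho &
    (forall th, norm_sq th = 1 -> ~ periodic_point phi (f (perturbed_ball x0 r a th))) /\
    (forall (th : 'I_n.+1 -> 'rV[R]_n) (t : 'I_n.+1 -> R),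
      injective th -> (forall i, norm_sq (th i) = 1) ->
      ~ forall i, phi (t i) (f (perturbed_ball x0 r a (th 0))) =
             f (perturbed_ball x0 r a (th i))).
Proof.
move=> ds /countable_injP[code codeI] nK r0 rho0 small inner.
have K0 : (0 < K)%N by apply: leq_ltn_trans nK.
pose Ix : countType := (nat + nat * 'I_K * {ffun 'I_n.+1 -> int} *
  {ffun 'I_n.+1 -> {ffun 'I_n -> int}})%type.
pose bad (i : nat) : set 'M[R]_(K, n.+1) := match @unpickle Ix i with
  | Some (inl N) => periodic_boundary phi f x0 r rho code N
  | Some (inr (M, k, ct, cu)) => itinerary_params phi f x0 r rho M k ct cu
  | None => set0 end.
have thb i : thin (bad i).
  rewrite /bad; case: unpickle => [[N|[[[M k] ct] cu]]|].
  - apply: (thin_periodic_boundary N r0 small inner K0 (ds_inj ds) _ codeI).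
    by move=> u u1; exists u.
  - exact: thin_itinerary_params.
  - by apply: thin_set0; rewrite muln_gt0 K0.
have [a arho nbad] := thin_cover_avoid thb rho0.
exists a => //; split.
  move=> th th1 per; apply: (nbad (@pickle Ix (inl (code (f (perturbed_ball x0 r a th)))))).
  by rewrite /bad pickleK; split=> //; exists th.
move=> th t thI th1 orb.
have [M [k [ct [cu bd]]]] := itinerary_paramsP ds nK arho (inner a arho) thI th1 orb.
by apply: (nbad (@pickle Ix (inr (M, k, ct, cu)))); rewrite /bad pickleK.
Qed.

Lemma flow_tube_closed (R : realType) (X : topologicalType) (phi : R -> X -> X)
    (eta : R) (E : set X) :
  hausdorff_space X -> continuous (fun p : R * X => phi p.1 p.2) -> compact E ->
  closed (flow_tube phi eta E).
Proof.
move=> hX phic cE; apply: compact_closed => //.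
have -> : flow_tube phi eta E =
    (fun p : R * X => phi p.1 p.2) @` (`[- eta, eta]%classic `*` E).
  apply/seteqP; split=> y.
    by move=> [s sI [x Ex <-]]; exists (s, x).
  by move=> [[s x] [/= sI Ex] <-]; exists s => //; exists x.
apply: continuous_compact; first by apply: continuous_subspaceT.
by apply: compact_setX => //; exact: segment_compact.
Qed.

(** A tube of positive measure would contain a point whose orbit returns to the
    tube at infinitely many multiples of [3 * eta].  Returns are corrected by
    times of absolute value at most [eta] to lie on the boundary itself, so
    distinct returns keep distinct times; two returns at the same boundary point
    would make this point periodic. *)
Lemma recurrence_free_small_boundary (R : realType) n K (X : ptopologicalType)
    (phi : R -> X -> X) (eta : R) (f : 'rV[R]_n -> X) (x0 : 'rV[R]_n) (r : R)
    (a : 'M[R]_(K, n.+1)) :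
  hausdorff_space X -> is_flow phi -> continuous (fun p : R * X => phi p.1 p.2) ->
  0 < eta -> compact (disc (f \o perturbed_ball x0 r a)) ->
  (forall u, norm_sq u < 1 ->
    flow_interior phi eta (disc (f \o perturbed_ball x0 r a))
      (f (perturbed_ball x0 r a u))) ->
  (forall th, norm_sq th = 1 -> ~ periodic_point phi (f (perturbed_ball x0 r a th))) ->
  (forall (th : 'I_n.+1 -> 'rV[R]_n) (t : 'I_n.+1 -> R),
      injective th -> (forall i, norm_sq (th i) = 1) ->
      ~ forall i, phi (t i) (f (perturbed_ball x0 r a (th 0))) =
             f (perturbed_ball x0 r a (th i))) ->
  small_flow_boundary phi eta (disc (f \o perturbed_ball x0 r a)).
Proof.
move=> hX fl phic eta0 cS intS nper norb mu inv.
have [f0 fD] := fl; set g := perturbed_ball x0 r a in cS intS nper norb *.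
set S := disc _ in cS intS *.
have clB : closed (flow_tube phi eta (flow_boundary phi eta S)).
  apply: flow_tube_closed => //.
  have -> : flow_boundary phi eta S = S `&` ~` (flow_tube phi eta S)°.
    by rewrite /flow_boundary /flow_interior setDIr setDv setU0.
  apply: compact_closedI => //; exact/open_closedC/open_interior.
have phitc t : continuous (phi t).
  move=> x B /(phic (t, x)) [[P Q] /= [tP xQ] PQ].
  apply: filterS xQ => z Qz; apply: (PQ (t, z)); split=> //.
  exact: nbhs_singleton tP.
have [//|muB] := eqVneq (mu (flow_tube phi eta (flow_boundary phi eta S))) 0%E.
have [y yB] := invariant_recurrence (3 * eta) fl phitc inv clB muB.
have /choice[nx nxP] : forall N : nat, exists k, (N <= k)%N /\
    flow_tube phi eta (flow_boundary phi eta S) (phi (k%:R * (3 * eta)) y).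
  by move=> N; have [k ? ?] := yB N; exists k.
(* [kap i] is the number of the [i]-th return *)
pose kap := fix kap i := if i is j.+1 then nx (kap j).+1 else nx 0%N.
have kapB i : flow_tube phi eta (flow_boundary phi eta S) (phi ((kap i)%:R * (3 * eta)) y).
  by case: i => [|i] /=; exact: (nxP _).2.
have kap_lt i j : (i < j)%N -> (kap i < kap j)%N.
  elim: j => // j IH; rewrite ltnS leq_eqVlt => /orP[/eqP->|/IH ij].
    exact: (nxP _).1.
  by apply: (ltn_trans ij); exact: (nxP _).1.
have /choice[w wP] : forall i : nat, exists w : R * 'rV[R]_n,
    [/\ - eta <= w.1 <= eta, norm_sq w.2 = 1 &
        f (g w.2) = phi ((kap i)%:R * (3 * eta) - w.1) y].
  move=> i; have [s sI [_ [[u Bu <-] nint] e]] := kapB i.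
  exists (s, u); split=> /=.
  - by move: sI; rewrite /= in_itv.
  - apply/eqP; rewrite eq_le; apply/andP; split; first exact: Bu.
    by rewrite leNgt; apply/negP => u1; apply: nint; exact: intS.
  - by rewrite addrC fD -e -fD addNr f0.
pose th (i : 'I_n.+1) := (w i).2.
pose t (i : 'I_n.+1) :=
  (kap i)%:R * (3 * eta) - (w i).1 - ((kap 0%N)%:R * (3 * eta) - (w 0%N).1).
exfalso; apply: (norb th t).
- have per (i j : 'I_n.+1) : (i < j)%N -> th i <> th j.
    move=> ij eij; have [/andP[i1 i2] i3 i4] := wP i; have [/andP[j1 j2] j3 j4] := wP j.
    apply: (nper (th i) i3).
    exists (((kap j)%:R * (3 * eta) - (w j).1) - ((kap i)%:R * (3 * eta) - (w i).1)).
      have : (kap i).+1%:R <= (kap j)%:R :> R by rewrite ler_nat kap_lt.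
      rewrite -natr1 => /(ler_wpM2r (ltW eta0)); lra.
    by rewrite /th {1}i4 -fD subrK -j4; congr (f (g _)); exact: esym.
  move=> i j eij; apply/val_inj/eqP; rewrite -[_ == _]negbK neq_ltn negb_or.
  apply/andP; split; apply/negP => ij; first exact: (per i j ij).
  by apply: (per j i ij).
- by move=> i; have [] := wP i.
- move=> i; have [_ _ ei] := wP i; have [_ _ e0] := wP 0%N.
  by rewrite /th ei e0 -fD subrK.
Qed.

(** A continuous flow on a discrete space is constant. *)
Lemma no_cross_section_dim0 (R : realType) (X : topologicalType)
    (A : set (chart R 0 X)) (phi : R -> X -> X) (eta : R) (S : set X) x :
  Ck_atlas 2 A -> Ck_flow 2 A phi -> cross_section phi eta S -> ~ S x.
Proof.
move=> [atl _] [[f0 fD] phic _] [eta0 cs] Sx.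
have [c Ac cx] := atl x.
have : nbhs (phi 0 x) (chart_dom c).
  by rewrite f0; apply: open_nbhs_nbhs; split=> //; exact: chart_dom_open.
move=> /(phic (0, x)) [[P Q] /= [/nbhs_ballP[e /= e0 eP] xQ] PQ].
pose t := Num.min (e / 2) eta.
have t0 : 0 < t by rewrite lt_min divr_gt0.
have te : t <= e / 2 by rewrite ge_min lexx.
have teta : t <= eta by rewrite ge_min lexx orbT.
have ct : chart_dom c (phi t x).
  apply: (PQ (t, x)); split=> /=; last exact: nbhs_singleton xQ.
  by apply: eP; rewrite /ball /= sub0r normrN gtr0_norm //; lra.
have tx : phi t x = phi 0 x.
  rewrite -(chart_mapK ct) f0 -[RHS](chart_mapK cx); congr chart_inv.
  by rewrite (thinmx0 (chart_map c (phi t x))) (thinmx0 (chart_map c x)).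
have [] := cs x x t 0 Sx Sx _ _ tx; rewrite ?in_itv /= ?in_itv /=.
- by apply/andP; split; lra.
- by apply/andP; split; lra.
- by move=> _; lra.
Qed.

Lemma generic_subdisc (R : realType) n (X : ptopologicalType)
    (A : set (chart R n.+1 X)) (phi : R -> X -> X) (eta : R)
    (U : set 'rV[R]_n) (f : 'rV[R]_n -> X) (ux : 'rV[R]_n) :
  disc_section A phi eta U f ->
  (forall t : R, 0 < t -> finite_set (periodic_orbits_lt phi t)) ->
  euclidean_ball ux -> (flow_tube phi eta (disc f))° (f ux) ->
  exists S : set X, [/\ S `<=` disc f,
    closed_cross_section phi eta S /\ transverse_C1_disc A phi S,
    flow_interior phi eta S (f ux) & small_flow_boundary phi eta S].
Proof.
move=> ds fin Bux int0; have [fl phic _] := ds_flow ds; have [f0 _] := fl.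
have [eta0 cs] := ds_cross ds.
have ux1 := flow_interior_in_open_disc ds Bux int0.
have : \forall w \near ux, norm_sq w < 1 /\ (flow_tube phi eta (disc f))° (f w).
  apply: filterI.
    exact: (@norm_sq_continuous _ _ ux _ (lt_nbhsl ux1)).
  apply: (disc_section_cts ds Bux); apply: open_nbhs_nbhs; split=> //.
  exact: open_interior.
move=> /nbhs_ballP[e /= e0 eP].
(* The perturbed balls stretch vectors of norm at most 2 to at most 7/3 < 4. *)
pose r := e / 4; have r0 : 0 < r by rewrite divr_gt0.
pose K := (n.+1 * n.+1 * n.+1).+1.
have [rho rho0 small] := small_paramP R K n.+1 n.
pose g (a : 'M[R]_(K, n.+1)) := perturbed_ball ux r a.
have gin a u : `|a| < rho -> `|u| <= 2 ->
    norm_sq (g a u) < 1 /\ (flow_tube phi eta (disc f))° (f (g a u)).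
  move=> arho u2; apply: eP; rewrite mx_norm_ball /ball_ /= /g /perturbed_ball.
  rewrite opprD addrA subrr add0r normrN normrZ gtr0_norm //.
  have := radial_map_bound (small _ arho) u2 => h.
  have h2 : `|radial_map a u| <= 7 / 3 by lra.
  by have := ler_wpM2l (ltW r0) h2; rewrite /r; lra.
have B2 (u : 'rV[R]_n) : norm_sq u <= 1 -> `|u| <= 2.
  by move=> /norm_sq_le1; lra.
have inner a : `|a| < rho -> forall u : 'rV[R]_n, norm_sq u <= 1 -> norm_sq (g a u) <= 1.
  by move=> arho u /B2 u2; apply/ltW; exact: (gin a u arho u2).1.
have cper := periodic_section_countable fl (ds_cross ds) fin.
have [a arho [nper norb]] := generic_param ds cper (leqnn K) r0 rho0 small inner.
have sa := small _ arho.
have Sd : disc (f \o g a) `<=` disc f.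
  by move=> _ [u Bu <-]; exists (g a u) => //; exact: inner.
have Bopen : open [set u : 'rV[R]_n | `|u| < 2].
  have -> : [set u : 'rV[R]_n | `|u| < 2] = ball 0 2.
    by apply/seteqP; split=> u; rewrite mx_norm_ball /ball_ /= sub0r normrN.
  exact: ball_open.
have Cg := C1_map_perturbed_ball ux r a.
have Sc : compact (disc (f \o g a)).
  rewrite /disc; apply: continuous_compact; last exact: euclidean_ball_compact.
  apply: continuous_in_subspaceT => u; rewrite inE => Bu.
  apply: continuous_comp; first exact: C1_map_continuous.
  by apply: (disc_section_cts ds); exact: inner.
have intS u : norm_sq u < 1 -> flow_interior phi eta (disc (f \o g a)) (f (g a u)).
  move=> u1; apply: (perturbed_flow_interior ds r0 sa) => // v Bv.
  by split; [exact: inner | exact: (gin a v arho (B2 _ Bv)).2].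
exists (disc (f \o g a)); split => //.
- split.
    split; first exact: compact_closed (ds_hausdorff ds) Sc.
    by split=> // x y s t /Sd Sx /Sd Sy; exact: cs.
  apply: (transverse_disc_comp (ds_C1 ds) (ds_inj ds) (ds_trans ds) Bopen) => //.
  + by move=> u /= /norm_sq_le1; lra.
  + move=> u /= u2; apply: (ds_ball ds); apply/ltW.
    exact: (gin a u arho (ltW u2)).1.
  + exact: inner.
  + move=> u v /B2 u2 /B2 v2; rewrite /g /perturbed_ball => /addrI /scalerI uv.
    have /uv {}uv : r != 0 by rewrite gt_eqF.
    have := radial_map_expand sa u2 v2; rewrite uv subrr normr0 mulr0 => h.
    by apply/eqP; rewrite -subr_eq0 -normr_eq0 eq_le h normr_ge0.
  + move=> u v Bu; rewrite diff_perturbed_ball => /eqP.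
    rewrite scaler_eq0 (gt_eqF r0) /= => /eqP; apply: diff_radial_inj => //.
    by have := norm_sq_le1 Bu; lra.
- have {1}<- : g a 0 = ux by rewrite /g /perturbed_ball /radial_map !scaler0 addr0.
  by apply: intS; rewrite /norm_sq big1 // => i _; rewrite mxE expr0n.
- apply: recurrence_free_small_boundary => //; exact: (ds_hausdorff ds).
Qed.

Theorem proposition2p1 (R : realType) (d : nat) (X : ptopologicalType)
    (A : set (chart R d X)) (phi : R -> X -> X) :
  compact_manifold 2 A ->
  Ck_flow 2 A phi ->
  regular_flow phi ->
  (forall t : R, 0 < t -> finite_set (periodic_orbits_lt phi t)) ->
  smooth_small_flow_boundary_property A phi.
Proof.
move=> [hX _ atl] flow _ fin x eta S' [_ cs].
case: d A atl flow => [|n] A atl flow.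
  by move=> _ [_ Sx]; case: (no_cross_section_dim0 atl flow cs Sx).
move=> [U [f [[oU BU] fC finj ftr SE]]].
rewrite SE in cs * => -[intx [ux Bux fx]].
have ds : disc_section A phi eta U f by split.
rewrite -fx in intx *; exists eta.
exact: generic_subdisc ds fin Bux intx.
Qed.
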